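(* Let $m\ge3$, $r\in(0,\pi/2)$, $c\ge0$ a constant, $(f,\Gamma)$ an elliptic data, and $g=e^{2\rho}g_0$, $\rho\in C^{2,\alpha}(\mathbb{A}(r,\pi/2])$, a conformal metric on $\mathbb{A}(r,\pi/2]$ with $f(\lambda(g))=0$ (and $\lambda(g)\in\overline\Gamma$) in $\mathbb{A}(r,\pi/2]$ and $h(g)=c$ on $\partial\mathbb{S}^m_+$. If the function $e^{2\rho}+|\nabla\rho|^2:\mathbb{A}(r,\pi/2]\to\mathbb{R}$ is proper, then $\lambda(g)$ is unbounded on $\mathbb{A}(r,\pi/2]$.
   Context: $\mathbb{S}^m\subset\mathbb{R}^{m+1}$ is the unit sphere with round metric $g_0$, gradient $\nabla$, norm $|\cdot|$; ${\bf n}=e_{m+1}$, $\mathbb{S}^m_+=\{x_{m+1}>0\}$; $\mathbb{A}(r,\pi/2]=\{x\in\mathbb{S}^m:r<d_{\mathbb{S}^m}(x,{\bf n})\le\pi/2\}$. $\lambda(g)$ are the eigenvalues of $g^{-1}\mathrm{Sch}(g)$, $\mathrm{Sch}(g)=\frac{1}{m-2}(\mathrm{Ric}(g)-\frac{R(g)}{2(m-1)}g)$. Elliptic data: $(f,\Gamma)$ with $\Gamma\subset\mathbb{R}^m$ an open convex symmetric cone, $\{x_i>0\ \forall i\}\subset\Gamma\subset\{\sum x_i>0\}$, and $f\in C^0(\overline\Gamma)\cap C^1(\Gamma)$ symmetric, $f=0$ on $\partial\Gamma$, $f>0$ on $\Gamma$, homogeneous of degree 1, all partial derivatives of $f$ positive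 on $\Gamma$. $h(g)=-e^{-\rho}\langle\nabla\rho,e_{m+1}\rangle$ on $\partial\mathbb{S}^m_+$ (normalized mean curvature w.r.t. $g$ and the unit normal pointing towards ${\bf n}$). Proper means preimages of compact sets are compact. *)

(* Defs.v *)
From HB Require Import structures.
From mathcomp Require Import all_boot all_order all_algebra all_fingroup.
From mathcomp Require Import all_classical all_reals all_analysis.
Set Implicit Arguments. Unset Strict Implicit. Unset Printing Implicit Defensive.
Import Order.TTheory GRing.Theory Num.Theory.
Import numFieldNormedType.Exports.
Local Open Scope classical_set_scope.
Local Open Scope ring_scope.

Section Defs.
Context {R : realType}.

Definition sqn (n : nat) (v : 'rV[R]_n) : R := \sum_(i < n) v 0 i ^+ 2.

Definition ebasis (n : nat) (i : 'I_n) : 'rV[R]_n := \row_(j < n) (i == j)%:R.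

Definition pd (n : nat) (i : 'I_n) (F : 'rV[R]_n -> R) (y : 'rV[R]_n) : R :=
  'D_(ebasis i) F y.

Definition sphere (m : nat) : set 'rV[R]_m.+1 := [set x | sqn x = 1].

(* round (geodesic) distance from x in S^m to the north pole n = e_{m+1} *)
Definition dist_north (m : nat) (x : 'rV[R]_m.+1) : R := acos (x 0 ord_max).

Definition annulus (m : nat) (r : R) : set 'rV[R]_m.+1 :=
  [set x | @sphere m x /\ r < dist_north x /\ dist_north x <= pi / 2].

Definition equator (m : nat) : set 'rV[R]_m.+1 :=
  [set x | @sphere m x /\ x 0 ord_max = 0].

(* inverse stereographic projection from the south pole -e_{m+1}:
   a chart R^m -> S^m \ {-e_{m+1}} (covers the closed upper hemisphere) *)
Definition istereo (m : nat) (y : 'rV[R]_m) : 'rV[R]_m.+1 :=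
  \row_(k < m.+1) match unlift ord_max k with
                  | Some i => 2 * y 0 i / (1 + sqn y)
                  | None => (1 - sqn y) / (1 + sqn y)
                  end.

(* stereographic projection from the south pole (inverse of istereo on the sphere) *)
Definition stereo (m : nat) (x : 'rV[R]_m.+1) : 'rV[R]_m :=
  \row_(i < m) (x 0 (lift ord_max i) / (1 + x 0 ord_max)).

Definition C1_on (n : nat) (U : set 'rV[R]_n) (F : 'rV[R]_n -> R) : Prop :=
  (forall y, U y -> differentiable F y) /\
  (forall i : 'I_n, {within U, continuous (pd i F)}).

Definition C2_on (n : nat) (U : set 'rV[R]_n) (F : 'rV[R]_n -> R) : Prop :=
  C1_on U F /\ (forall i : 'I_n, C1_on U (pd i F)).

Definition C2alpha_loc (n : nat) (alpha : R) (U : set 'rV[R]_n)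
    (F : 'rV[R]_n -> R) : Prop :=
  C2_on U F /\
  forall K, compact K -> K `<=` U -> exists C : R,
    forall (i j : 'I_n) y z, K y -> K z ->
      `|pd j (pd i F) y - pd j (pd i F) z| <= C * (`|y - z| `^ alpha).

Section Metric.
Variable m : nat.
Variable rho : 'rV[R]_m.+1 -> R.

Definition rhoc (y : 'rV[R]_m) : R := rho (istereo y).

(* round metric g_0 in coordinates: pullback of the Euclidean metric *)
Definition g0c (i j : 'I_m) (y : 'rV[R]_m) : R :=
  \sum_(k < m.+1) pd i (fun z => istereo z 0 k) y * pd j (fun z => istereo z 0 k) y.

Definition g0mx (y : 'rV[R]_m) : 'M[R]_m := \matrix_(i, j) g0c i j y.

Definition gc (i j : 'I_m) (y : 'rV[R]_m) : R := expR (2 * rhoc y) * g0c i j y.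

Definition gmx (y : 'rV[R]_m) : 'M[R]_m := \matrix_(i, j) gc i j y.

Definition ginv (y : 'rV[R]_m) : 'M[R]_m := invmx (gmx y).

Definition christ (k i j : 'I_m) (y : 'rV[R]_m) : R :=
  2^-1 * \sum_(l < m) ginv y k l *
     (pd i (gc j l) y + pd j (gc i l) y - pd l (gc i j) y).

Definition ricci (i j : 'I_m) (y : 'rV[R]_m) : R :=
  \sum_(k < m) (pd k (christ k i j) y - pd j (christ k i k) y +
     \sum_(l < m) (christ k k l y * christ l i j y - christ k j l y * christ l i k y)).

Definition scal (y : 'rV[R]_m) : R :=
  \sum_(i < m) \sum_(j < m) ginv y i j * ricci i j y.

Definition schouten (i j : 'I_m) (y : 'rV[R]_m) : R :=
  (m%:R - 2)^-1 * (ricci i j y - scal y / (2 * (m%:R - 1)) * gc i j y).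

Definition gSch (x : 'rV[R]_m.+1) : 'M[R]_m :=
  ginv (stereo x) *m (\matrix_(i, j) schouten i j (stereo x)).

(* round gradient of rho at x, as a vector of R^{m+1} tangent to S^m *)
Definition grad0 (x : 'rV[R]_m.+1) : 'rV[R]_m.+1 :=
  \row_(k < m.+1) \sum_(i < m) \sum_(j < m)
     invmx (g0mx (stereo x)) i j * pd j rhoc (stereo x)
       * pd i (fun z => istereo z 0 k) (stereo x).

Definition grad0_sq (x : 'rV[R]_m.+1) : R :=
  \sum_(i < m) \sum_(j < m)
     invmx (g0mx (stereo x)) i j * pd i rhoc (stereo x) * pd j rhoc (stereo x).

(* normalized boundary mean curvature h(g) = - e^{-rho} <grad rho, e_{m+1}> *)
Definition hmean (x : 'rV[R]_m.+1) : R :=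
  - expR (- rho x) * grad0 x 0 ord_max.

End Metric.

Definition eigvals (m : nat) (M : 'M[R]_m) (lam : 'rV[R]_m) : Prop :=
  char_poly M = \prod_(i < m) ('X - (lam 0 i)%:P).

Definition permv (m : nat) (s : 'S_m) (v : 'rV[R]_m) : 'rV[R]_m :=
  \row_(i < m) v 0 (s i).

Definition elliptic_data (m : nat) (f : 'rV[R]_m -> R) (Ga : set 'rV[R]_m) : Prop :=
  open Ga /\
  (forall (l : 'rV[R]_m) (t : R), Ga l -> 0 < t -> Ga (t *: l)) /\
  (forall (a b : 'rV[R]_m) (t : R), Ga a -> Ga b -> 0 <= t -> t <= 1 -> Ga (t *: a + (1 - t) *: b)) /\
  (forall (s : 'S_m) (l : 'rV[R]_m), Ga l <-> Ga (permv s l)) /\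
  (forall l : 'rV[R]_m, (forall i, 0 < l 0 i) -> Ga l) /\
  (forall l : 'rV[R]_m, Ga l -> 0 < \sum_(i < m) l 0 i) /\
  {within closure Ga, continuous f} /\
  C1_on Ga f /\
  (forall (s : 'S_m) (l : 'rV[R]_m), f (permv s l) = f l) /\
  (forall l : 'rV[R]_m, closure Ga l -> ~ Ga l -> f l = 0) /\
  (forall l : 'rV[R]_m, Ga l -> 0 < f l) /\
  (forall (l : 'rV[R]_m) (t : R), closure Ga l -> 0 < t -> f (t *: l) = t * f l) /\
  (forall (l : 'rV[R]_m) (i : 'I_m), Ga l -> 0 < pd i f l).

Definition proper_on (n : nat) (A : set 'rV[R]_n) (F : 'rV[R]_n -> R) : Prop :=
  forall K : set R, compact K -> compact [set x | A x /\ K (F x)].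

End Defs.

Arguments sphere {R} m.
Arguments annulus {R} m r.
Arguments equator {R} m.
Arguments stereo {R m}.
Arguments istereo {R m}.
Arguments sqn {R n}.
Arguments dist_north {R m}.

(* Main.v *)
(* Stereographic projection from the south pole turns g into exp (2 theta) |dy|^2
   on the shell d2 < |y|^2 <= 1, and g^-1 Sch(g) into the symmetric matrix
     M = exp (- 2 theta) (- D^2 theta + D theta (x) D theta - |D theta|^2 / 2 I).
   Suppose lambda(g) is bounded; then so is the Frobenius norm of M, whose square
   is the sum of the squared eigenvalues.

   First, theta tends to +oo at the inner sphere. If theta(y) <= B, follow a unit
   direction e orthogonal to y along which theta does not increase at y: the line
   moves away from the inner sphere. Along it (exp (- 2 theta))'' is bounded below,
   so theta stays bounded above for a time depending only on B, and
   P = exp (- theta) |D theta|^2 satisfies |P'| <= D (1 + P). At the end of the line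
   P is bounded by compactness, hence |D theta| is bounded on {theta <= B};
   properness then keeps {theta <= B} away from the inner sphere.

   Consequently theta + ln (|y|^2 - d2 / 2) attains its minimum on the shell. At an
   interior minimum this contradicts tr M >= 0, because the hyperbolic metric
   (|y|^2 - d2 / 2)^-2 |dy|^2 has negative Schouten tensor; at a minimum on |y| = 1
   it contradicts h(g) >= 0. *)

Require Import Defs.
From HB Require Import structures.
From mathcomp Require Import all_boot all_order all_algebra all_fingroup.
From mathcomp Require Import all_classical all_reals all_analysis.
From mathcomp Require Import ring lra.
Set Implicit Arguments. Unset Strict Implicit. Unset Printing Implicit Defensive.
Import Order.TTheory GRing.Theory Num.Theory.
Import numFieldNormedType.Exports.
Local Open Scope classical_set_scope.
Local Open Scope ring_scope.

(** * Directional derivatives and differentiability *)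

Section DirectionalCalculus.
Context {R : realType}.

(** Reduces a directional derivative to one real variable, where the chain rule and the mean value
    theorem are available. *)
Lemma is_derive_lineP (V : normedModType R) (f : V -> R) (x v : V) (df : R) :
  is_derive x v f df <-> is_derive (0 : R) 1 (fun h : R => f (h *: v + x)) df.
Proof.
have E : 'D_1 (fun h : R => f (h *: v + x)) 0 = 'D_v f x.
  rewrite /derive; set g1 := fun h => h^-1 *: _; set g2 := fun h => h^-1 *: _.
  suff -> : g1 = g2 by [].
  by apply/funext => h; rewrite /g1 /g2 /= addr0 scale0r add0r [_%:A]mulr1.
split=> -[dv De]; constructor.
- exact: (iffLR (derivable1P f x v)).
- by rewrite E.
- exact: (iffRL (derivable1P f x v)).
- by rewrite -E.
Qed.

Lemma is_derive_compR (V : normedModType R) (g : R -> R) (f : V -> R)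
    (x v : V) (dg df : R) :
  is_derive (f x) 1 g dg -> is_derive x v f df ->
  is_derive x v (fun z => g (f z)) (dg * df).
Proof.
move=> dgx /is_derive_lineP dfx; apply/is_derive_lineP.
have dg0 : is_derive (f (0 *: v + x)) 1 g dg by rewrite scale0r add0r.
exact: (is_derive1_comp dg0 dfx).
Qed.

(** [g] inherits the first-order expansion of [f] at [x], and the differential is unique. It serves
    for formulas that hold only on an open set, such as the one for the derivatives of [theta]. *)
Lemma near_eq_differentiable (V W : normedModType R) (f g : V -> W) (x : V) :
  {near x, f =1 g} -> differentiable f x -> differentiable g x.
Proof.
move=> fg df.
have E : g \o shift x = cst (g x) + 'd f x +o_ 0 id.
  apply/eqaddoP => e e0.
  have /diff_locallyP[_ /eqaddoP/(_ e e0) H] := df.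
  have fg0 : \forall k \near (0 : V), f (k + x) = g (k + x).
    have /nbhs_ballP[r /= r0 Hr] := fg.
    apply/nbhs_ballP; exists r => //= k; rewrite -ball_normE /ball_/= sub0r normrN => kr.
    by apply: Hr; rewrite -ball_normE /ball_/= opprD addrCA subrr addr0 normrN.
  near=> k.
  have -> : (g \o shift x - (cst (g x) + 'd f x)) k =
      (f \o shift x - (cst (f x) + 'd f x)) k.
    rewrite !fctE/= (near fg0 k)//; congr (_ - (_ + _)).
    by rewrite (nbhs_singleton fg).
  by near: k.
apply/diff_locallyP.
have D : 'd g x = 'd f x :> (V -> W).
  exact: (@diff_unique R V W g ('d f x) x (diff_continuous df) E).
by rewrite D; split; [exact: diff_continuous|exact: E].
Unshelve. all: by end_near. Qed.

Lemma derive_sum_pd n (F : 'rV[R]_n -> R) (y v : 'rV[R]_n) :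
  differentiable F y -> 'D_v F y = \sum_(i < n) v 0 i * pd i F y.
Proof.
move=> dF; rewrite deriveE//.
rewrite (_ : v = \sum_(i < n) v 0 i *: ebasis i); last first.
  apply/rowP => j; rewrite summxE (bigD1 j)//= big1 ?addr0; last first.
    by move=> i /negbTE ij; rewrite !mxE ij mulr0.
  by rewrite !mxE eqxx mulr1.
rewrite linear_sum; apply: eq_bigr => i _.
rewrite [LHS]linearZ/= /pd deriveE//; congr (_ * _).
rewrite summxE (bigD1 i)//= big1 ?addr0; last first.
  by move=> j /negbTE ji; rewrite !mxE ji mulr0.
by rewrite !mxE eqxx mulr1.
Qed.

Lemma is_derive_line n (F : 'rV[R]_n -> R) (y v : 'rV[R]_n) (t : R) :
  differentiable F (y + t *: v) ->
  is_derive t 1 (fun s : R => F (y + s *: v))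
    (\sum_(i < n) v 0 i * pd i F (y + t *: v)).
Proof.
move=> dF; rewrite -derive_sum_pd//.
have := derivableP (@diff_derivable _ _ _ F _ v dF).
move=> /is_derive_lineP h; apply/is_derive_lineP.
rewrite (_ : (fun _ => _) = (fun h : R => F (h *: v + (y + t *: v))))//.
by apply/funext => s; rewrite [s *: 1]mulr1 scalerDl addrCA.
Qed.

Lemma is_derive_coord n (y v : 'rV[R]_n) (i : 'I_n) :
  is_derive y v (fun z : 'rV[R]_n => z 0 i) (v 0 i).
Proof.
apply/is_derive_lineP.
rewrite (_ : (fun _ => _) = (fun h : R => h * v 0 i + y 0 i)); last first.
  by apply/funext => h; rewrite !mxE.
by apply: is_derive_eq; rewrite addr0 scaler0 add0r [_ *: _]mulr1.
Qed.

Lemma is_derive_sqn n (y v : 'rV[R]_n) :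
  is_derive y v sqn (2 * \sum_(i < n) v 0 i * y 0 i).
Proof.
rewrite (_ : sqn = \sum_(i < n) (fun z : 'rV[R]_n => z 0 i ^+ 2)); last first.
  by apply/funext => z; rewrite fct_sumE.
apply: (is_derive_eq (is_derive_sum (fun i => is_deriveX 2 (is_derive_coord y v i)))).
by rewrite mulr_sumr; apply: eq_bigr => i _; rewrite expr1 /GRing.scale/=; ring.
Qed.

Lemma differentiable_sqn n (y : 'rV[R]_n) : differentiable sqn y.
Proof.
rewrite (_ : sqn = \sum_(i < n) ((fun z : 'rV[R]_n => z 0 i) * (fun z => z 0 i))).
  by apply: differentiable_sum => i; apply: differentiableM; exact: differentiable_coord.
by apply/funext => z; rewrite fct_sumE.
Qed.

Lemma pd_sqn n (y : 'rV[R]_n) i : pd i sqn y = 2 * y 0 i.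
Proof.
rewrite /pd (@derive_val _ _ _ _ _ _ _ (is_derive_sqn y (ebasis i))).
rewrite (bigD1 i)//= big1 ?addr0; last by move=> j /negbTE ji; rewrite mxE eq_sym ji mul0r.
by rewrite mxE eqxx mul1r.
Qed.

Lemma nondecreasing_derive (g g' : R -> R) (a b : R) : a <= b ->
  (forall t, a <= t <= b -> is_derive t 1 g (g' t)) ->
  (forall t, a <= t <= b -> 0 <= g' t) -> g a <= g b.
Proof.
move=> ab dg g0.
have [] := @MVT_segment _ g g' _ _ ab.
- by move=> t; rewrite in_itv/= => /andP[/ltW ? /ltW ?]; apply: dg; apply/andP.
- apply: derivable_within_continuous => t; rewrite in_itv/= => tab.
  by have := dg _ tab => /@ex_derive.
move=> c; rewrite in_itv/= => cab E.
by rewrite -subr_ge0 E mulr_ge0 ?g0// subr_ge0.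
Qed.

End DirectionalCalculus.

(** * Symmetry of second derivatives *)

Section Schwarz.
Context {R : realType}.

(** The mean value theorem in the direction [a], applied to the increment of [F] by [h *: b],
    followed by the first-order expansion of ['D_a F] at [y]. Differentiability of ['D_a F] at the
    single point [y] suffices. *)
Lemma second_difference n (F : 'rV[R]_n -> R) (y a b : 'rV[R]_n) (e : R) :
  0 < e -> (\forall z \near y, differentiable F z) ->
  differentiable (fun z => 'D_a F z) y ->
  \forall h \near (0 : R)^'+,
    `|F (y + h *: a + h *: b) - F (y + h *: a) - F (y + h *: b) + F y
      - h ^+ 2 * 'D_b (fun z => 'D_a F z) y| <= e * h ^+ 2.
Proof.
move=> e0 dF dG; set G := (fun z => 'D_a F z) in dG *.
(* For s, t in [0, h] the vector s a + t b has norm at most h K; [d] makes the two expansion errors,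
   each at most d h K, add up to e h. *)
pose K := `|a| + `|b| + 1.
have K0 : 0 < K by rewrite ltr_wpDl// addr_ge0.
pose d := e / (2 * K).
have d0 : 0 < d by rewrite divr_gt0// mulr_gt0.
have [r1 /= r10 Hr1] : exists2 r : R, 0 < r & forall k, `|k| < r -> differentiable F (y + k).
  have /nbhs_ballP[r /= r0 Hr] := dF; exists r => // k kr; apply: Hr.
  by rewrite -ball_normE /ball_/= opprD addrA subrr sub0r normrN.
have [r2 /= r20 Hr2] : exists2 r : R, 0 < r & forall k, `|k| < r ->
    `|G (y + k) - G y - 'd G y k| <= d * `|k|.
  have E := diff_locallyxC dG.
  have /nbhs_ballP[r /= r0 Hr] : \forall k \near (0 : 'rV[R]_n),
      `|G (y + k) - G y - 'd G y k| <= d * `|k|.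
    near=> k; rewrite E.
    have cancel (p q o : R) : p + q + o - p - q = o by ring.
    rewrite cancel.
    near: k; exact: littleoP.
  exists r => // k kr; apply: Hr.
  by rewrite -ball_normE /ball_/= sub0r normrN.
near=> h.
have h0 : 0 < h by near: h; exact: nbhs_right_gt.
have hK : h * K < Num.min r1 r2.
  rewrite -ltr_pdivlMr//; near: h; apply: nbhs_right_lt.
  by rewrite divr_gt0// lt_min r10.
have hr1 : h * K < r1 by move: hK; rewrite lt_min => /andP[].
have hr2 : h * K < r2 by move: hK; rewrite lt_min => /andP[].
have nrm s t : 0 <= s <= h -> 0 <= t <= h -> `|s *: a + t *: b| <= h * K.
  move=> /andP[s0 sh] /andP[t0 th].
  rewrite (le_trans (ler_normD _ _))// !normrZ !ger0_norm//.
  have := ler_wpM2r (normr_ge0 a) sh; have := ler_wpM2r (normr_ge0 b) th.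
  by rewrite /K; lra.
have dFst s t : 0 <= s <= h -> 0 <= t <= h -> differentiable F (y + t *: b + s *: a).
  move=> sh th; rewrite -addrA [t *: b + _]addrC; apply: Hr1.
  by rewrite (le_lt_trans (nrm _ _ sh th)).
pose phi s := F (y + h *: b + s *: a) - F (y + 0 *: b + s *: a).
pose phi' s := G (y + h *: b + s *: a) - G (y + 0 *: b + s *: a).
have hh : 0 <= h <= h by rewrite lexx ltW.
have z0 : 0 <= (0:R) <= h by rewrite lexx ltW.
have dphi s : 0 <= s <= h -> is_derive s 1 phi (phi' s).
  move=> sh; rewrite /phi' /G (derive_sum_pd a (dFst s h sh hh)).
  rewrite (derive_sum_pd a (dFst s 0 sh z0)).
  by apply: is_deriveB; apply: is_derive_line; exact: dFst.
have [] := @MVT_segment _ phi phi' _ _ (ltW h0).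
- by move=> t; rewrite in_itv/= => /andP[/ltW ? /ltW ?]; apply: dphi; apply/andP.
- apply: derivable_within_continuous => t; rewrite in_itv/= => tab.
  by have := dphi _ tab => /@ex_derive.
move=> c; rewrite in_itv/= subr0 => ch E.
have E1 := Hr2 _ (le_lt_trans (nrm _ _ ch hh) hr2).
have E2 := Hr2 _ (le_lt_trans (nrm _ _ ch z0) hr2).
have -> : F (y + h *: a + h *: b) - F (y + h *: a) - F (y + h *: b) + F y = phi' c * h.
  by rewrite -E /phi !scale0r !addr0 (addrAC y (h *: b)); ring.
rewrite deriveE//.
(* In the difference of the two expansions the terms ['d G y (c *: a)] cancel and [h * 'd G y b]
   remains. *)
have -> : phi' c * h - h ^+ 2 * 'd G y b =
    h * ((G (y + (c *: a + h *: b)) - G y - 'd G y (c *: a + h *: b))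
      - (G (y + (c *: a + 0 *: b)) - G y - 'd G y (c *: a + 0 *: b))).
  rewrite /phi' scale0r !addr0 -[y + h *: b + _]addrA [h *: b + _]addrC.
  have -> : 'd G y (c *: a + h *: b) = 'd G y (c *: a) + h * 'd G y b.
    by rewrite linearD; congr (_ + _); exact: linearZ.
  ring.
rewrite normrM (gtr0_norm h0) expr2 mulrCA ler_pM2l//.
rewrite (le_trans (ler_normB _ _))//.
rewrite (le_trans (lerD E1 E2))// -mulrDr.
rewrite (_ : e * h = d * (h * K + h * K)); last first.
  by rewrite /d; field; rewrite gt_eqF.
by apply: ler_wpM2l; [exact: ltW|apply: lerD; exact: nrm].
Unshelve. all: by end_near. Qed.

(** The second difference is symmetric in the two directions, and after division by h^2 it is within
    e / 2 of either mixed derivative. *)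
Lemma pd_comm n (F : 'rV[R]_n -> R) (y : 'rV[R]_n) (i j : 'I_n) :
  (\forall z \near y, differentiable F z) ->
  differentiable (pd i F) y -> differentiable (pd j F) y ->
  pd i (pd j F) y = pd j (pd i F) y.
Proof.
move=> dF di dj; apply/eqP; rewrite -subr_eq0 -normr_eq0 eq_le normr_ge0 andbT.
apply/ler_addgt0Pl => e e0; rewrite addr0.
have e20 : 0 < e / 2 by rewrite divr_gt0.
have Hi := @second_difference n F y (ebasis i) (ebasis j) (e / 2) e20 dF di.
have Hj := @second_difference n F y (ebasis j) (ebasis i) (e / 2) e20 dF dj.
have [h [h0 [HJ HI]]] := filter_ex (filterI (nbhs_right_gt (0 : R)) (filterI Hj Hi)).
move: HI HJ; rewrite -!/(pd _ _ _).
rewrite (_ : y + h *: ebasis j + h *: ebasis i = y + h *: ebasis i + h *: ebasis j); last first.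
  by rewrite addrAC.
set A := F (_ + _ + _); set B := F (_ + h *: ebasis i); set C := F (_ + _).
set p := pd i _ _; set q := pd j _ _.
move=> /ler_normlP[H1 H2] /ler_normlP[H3 H4].
clearbody A B C p q.
have h20 : 0 < h ^+ 2 by rewrite exprn_gt0.
by apply/ler_normlP; split; rewrite -(ler_pM2l h20); lra.
Qed.

End Schwarz.

(** * Eigenvalues, trace and Frobenius norm *)

Section Eigenvalues.
Context {R : realType}.

Lemma char_poly_comp m (M : 'M[R]_m) (q : {poly R}) :
  char_poly M \Po q = \det (q%:M - map_mx polyC M).
Proof.
rewrite /char_poly -[LHS]/(comp_poly q _) -det_map_mx /char_poly_mx.
congr (\det _); apply/matrixP => i j; rewrite !mxE rmorphB/= comp_polyC rmorphMn/=.
by rewrite comp_polyX.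
Qed.

(** Taking determinants in X^2 - M^2 = (X - M)(X + M) expresses the characteristic polynomial of M^2
    at X^2 through that of M at X and at -X; no diagonalization is involved. *)
Lemma eigvals_mulmx_self m (M : 'M[R]_m) (lam : 'rV[R]_m) :
  eigvals M lam -> eigvals (M *m M) (\row_i lam 0 i ^+ 2).
Proof.
rewrite /eigvals => E.
have E2 : char_poly (M *m M) \Po 'X^2 =
    (\prod_(i < m) ('X - (lam 0 i ^+ 2)%:P)) \Po 'X^2.
  rewrite char_poly_comp.
  have -> : ('X^2)%:M - map_mx polyC (M *m M) =
      ('X%:M - map_mx polyC M) *m ('X%:M + map_mx polyC M) :> 'M[{poly R}]_m.
    rewrite mulmxDr !mulmxBl -!scalar_mxM -expr2 map_mxM scalar_mxC.
    by rewrite addrA subrK.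
  rewrite det_mulmx -/(char_poly_mx M) -/(char_poly M).
  have -> : \det ('X%:M + map_mx polyC M) = (-1) ^+ m * (char_poly M \Po - 'X).
    rewrite char_poly_comp -detZ; congr (\det _).
    by apply/matrixP => i j; rewrite !mxE; case: (i == j); rewrite ?mulr1n ?mulr0n; ring.
  rewrite E !rmorph_prod/= mulrCA -big_split/=.
  have -> : (-1) ^+ m = \prod_(i < m) (-1) :> {poly R} by rewrite prodr_const card_ord.
  rewrite -big_split/=; apply: eq_bigr => i _.
  by rewrite !comp_polyB !comp_polyX !comp_polyC rmorphXn/=; ring.
(* Substituting X^2 is injective: the coefficient of index 2i gives back the one of index i. *)
apply/polyP => i; have /polyP/(_ (i * 2)%N) := E2.
rewrite !coef_comp_poly_Xn// dvdn_mull// mulnK// => ->.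
by under [in RHS]eq_bigr do rewrite mxE.
Qed.

Lemma eigvals_trace m (M : 'M[R]_m) (lam : 'rV[R]_m) :
  eigvals M lam -> \tr M = \sum_i lam 0 i.
Proof.
case: m M lam => [|m] M lam E; first by rewrite /mxtrace !big_ord0.
apply: oppr_inj; rewrite -char_poly_trace// E.
have := @coefPn_prod_XsubC R [seq lam 0 i | i <- enum 'I_m.+1].
rewrite size_map size_enum_ord => /(_ isT).
by rewrite !big_map -!enumT !big_enum.
Qed.

(** For symmetric M the trace of M^2 is the sum of the squared entries. This turns a bound on the
    eigenvalues into a bound on the entries. *)
Lemma eigvals_frobenius m (M : 'M[R]_m) (lam : 'rV[R]_m) :
  M^T = M -> eigvals M lam -> \sum_i \sum_j M i j ^+ 2 = \sum_i lam 0 i ^+ 2.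
Proof.
move=> MT /eigvals_mulmx_self/eigvals_trace.
rewrite [RHS](eq_bigr (fun i => lam 0 i ^+ 2)); last by move=> i _; rewrite mxE.
move=> <-; apply: eq_bigr => i _; rewrite mxE; apply: eq_bigr => j _.
by rewrite -{3}MT mxE.
Qed.

(** 2|ab| <= a^2 + b^2 entrywise. It is applied with [A] the Schouten matrix and [B] of rank one. *)
Lemma sum_prod_le m (A B : 'I_m -> 'I_m -> R) :
  `|\sum_i \sum_j A i j * B i j| <=
    2^-1 * (\sum_i \sum_j A i j ^+ 2 + \sum_i \sum_j B i j ^+ 2).
Proof.
rewrite (le_trans (ler_norm_sum _ _ _))// -big_split/= mulr_sumr ler_sum// => i _.
rewrite (le_trans (ler_norm_sum _ _ _))// -big_split/= mulr_sumr ler_sum// => j _.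
apply/ler_normlP; move: (A i j) (B i j) => a b.
by have := sqr_ge0 (a - b); have := sqr_ge0 (a + b); rewrite sqrrB sqrrD; split; lra.
Qed.

Lemma sum_deltal m (i : 'I_m) (F : 'I_m -> R) : \sum_l (i == l)%:R * F l = F i.
Proof.
rewrite (bigD1 i)//= eqxx mul1r big1 ?addr0// => j /negbTE.
by rewrite eq_sym => ->; rewrite mul0r.
Qed.

Lemma sum_ord_const m (x : R) : \sum_(i < m) x = m%:R * x.
Proof. by rewrite sumr_const card_ord mulr_natl. Qed.

End Eigenvalues.

(** * Stereographic projection and the round metric *)

Section StereographicChart.
Context {R : realType}.

Lemma sqn_ge0 n (y : 'rV[R]_n) : 0 <= sqn y.
Proof. by apply: sumr_ge0 => i _; exact: sqr_ge0. Qed.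

Lemma add1_sqn_gt0 n (y : 'rV[R]_n) : 0 < 1 + sqn y.
Proof. by rewrite ltr_pwDl// sqn_ge0. Qed.

Lemma add1_sqn_neq0 n (y : 'rV[R]_n) : 1 + sqn y != 0.
Proof. by rewrite gt_eqF// add1_sqn_gt0. Qed.

Lemma sum_lift_max m (F : 'I_m.+1 -> R) :
  \sum_k F k = \sum_(i < m) F (lift ord_max i) + F ord_max.
Proof.
rewrite big_ord_recr/=; congr (_ + _); apply: eq_bigr => i _; congr F.
by apply: val_inj; rewrite /= /bump leqNgt ltn_ord.
Qed.

Lemma is_derive_mulf (V : normedModType R) (f g : V -> R) (x v : V) (df dg : R) :
  is_derive x v f df -> is_derive x v g dg ->
  is_derive x v (fun z => f z * g z) (f x * dg + g x * df).
Proof. by move=> ? ?; apply: is_deriveM. Qed.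

Lemma is_derive_mull (V : normedModType R) (c : R) (f : V -> R) (x v : V) (df : R) :
  is_derive x v f df -> is_derive x v (fun z => c * f z) (c * df).
Proof. by move=> ?; apply: is_deriveZ. Qed.

Lemma is_derive_addf (V : normedModType R) (f g : V -> R) (x v : V) (df dg : R) :
  is_derive x v f df -> is_derive x v g dg ->
  is_derive x v (fun z => f z + g z) (df + dg).
Proof. by move=> ? ?; apply: is_deriveD. Qed.

Lemma is_derive_subf (V : normedModType R) (f g : V -> R) (x v : V) (df dg : R) :
  is_derive x v f df -> is_derive x v g dg ->
  is_derive x v (fun z => f z - g z) (df - dg).
Proof. by move=> ? ?; apply: is_deriveB. Qed.

Lemma is_derive_add1_sqn n (y v : 'rV[R]_n) :
  is_derive y v (fun z => 1 + sqn z) (2 * \sum_(i < n) v 0 i * y 0 i).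
Proof.
have := is_derive_addf (is_derive_cst (1 : R) y v) (is_derive_sqn y v).
by rewrite add0r.
Qed.

Lemma is_derive_inv_add1_sqn n (y v : 'rV[R]_n) :
  is_derive y v (fun z => (1 + sqn z)^-1)
    (- (1 + sqn y) ^- 2 * (2 * \sum_(i < n) v 0 i * y 0 i)).
Proof.
apply: (@is_derive_compR _ _ (fun t : R => t^-1)); last exact: is_derive_add1_sqn.
have := @is_deriveV R id (1 + sqn y) 1 1 (add1_sqn_neq0 y) (is_derive_id _ _).
by rewrite [_ *: _]mulr1.
Qed.

Lemma sum_ebasis n (i : 'I_n) (F : 'I_n -> R) : \sum_j ebasis i 0 j * F j = F i.
Proof. by rewrite -[RHS](sum_deltal i); apply: eq_bigr => j _; rewrite mxE. Qed.

Lemma pd_istereo_lift m (y : 'rV[R]_m) (i l : 'I_m) :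
  pd i (fun z => istereo z 0 (lift ord_max l)) y =
  2 * (i == l)%:R / (1 + sqn y) - 4 * y 0 l * y 0 i / (1 + sqn y) ^+ 2.
Proof.
rewrite (_ : (fun z => _) = (fun z : 'rV[R]_m => 2 * z 0 l * (1 + sqn z)^-1)); last first.
  by apply/funext => z; rewrite mxE liftK.
rewrite /pd (@derive_val _ _ _ _ _ _ _ (is_derive_mulf
  (is_derive_mull 2 (is_derive_coord y (ebasis i) l))
  (is_derive_inv_add1_sqn y (ebasis i)))).
rewrite sum_ebasis mxE.
by field; exact: add1_sqn_neq0.
Qed.

Lemma pd_istereo_max m (y : 'rV[R]_m) (i : 'I_m) :
  pd i (fun z => istereo z 0 ord_max) y = - 4 * y 0 i / (1 + sqn y) ^+ 2.
Proof.
rewrite (_ : (fun z => _) = (fun z : 'rV[R]_m => 2 * (1 + sqn z)^-1 - 1)); last first.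
  by apply/funext => z; rewrite mxE unlift_none; field; exact: add1_sqn_neq0.
rewrite /pd (@derive_val _ _ _ _ _ _ _ (is_derive_subf
  (is_derive_mull 2 (is_derive_inv_add1_sqn y (ebasis i)))
  (is_derive_cst (1 : R) y (ebasis i)))).
rewrite sum_ebasis.
by field; exact: add1_sqn_neq0.
Qed.

(** Stereographic projection is conformal: with q = 1 + |y|^2, the terms in y_i y_j have
    coefficients -16 / q^3, 16 (q - 1) / q^4 and 16 / q^4, which cancel. *)
Lemma g0cE m (i j : 'I_m) (y : 'rV[R]_m) :
  g0c i j y = 4 / (1 + sqn y) ^+ 2 * (i == j)%:R.
Proof.
rewrite /g0c sum_lift_max !pd_istereo_max.
set q := 1 + sqn y; have q0 : q != 0 by exact: add1_sqn_neq0.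
rewrite (eq_bigr (fun l => (i == l)%:R * (4 / q ^+ 2 * (j == l)%:R - 8 * y 0 l * y 0 j / q ^+ 3)
    - (j == l)%:R * (8 * y 0 l * y 0 i / q ^+ 3)
    + 16 * y 0 i * y 0 j / q ^+ 4 * y 0 l ^+ 2)); last first.
  by move=> l _; rewrite !pd_istereo_lift -/q; field.
rewrite big_split/= sumrB !sum_deltal -mulr_sumr -/(sqn y).
have -> : sqn y = q - 1 by rewrite /q addrAC subrr add0r.
by rewrite [j == i]eq_sym; field.
Qed.

Lemma sphere_istereo m (y : 'rV[R]_m) : sphere m (istereo y).
Proof.
rewrite /sphere/= /sqn sum_lift_max.
rewrite (eq_bigr (fun l => 4 / (1 + sqn y) ^+ 2 * y 0 l ^+ 2)); last first.
  by move=> l _; rewrite mxE liftK; field; exact: add1_sqn_neq0.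
rewrite mxE unlift_none -mulr_sumr -/(sqn y).
by field; exact: add1_sqn_neq0.
Qed.

Lemma istereo_max m (y : 'rV[R]_m) :
  istereo y 0 ord_max = (1 - sqn y) / (1 + sqn y).
Proof. by rewrite mxE unlift_none. Qed.

Lemma istereoK m : cancel (@istereo R m) stereo.
Proof.
move=> y; apply/rowP => i; rewrite !mxE liftK unlift_none.
have q0 := add1_sqn_neq0 y.
have -> : 1 + (1 - sqn y) / (1 + sqn y) = 2 / (1 + sqn y) by field.
by field; rewrite q0.
Qed.

End StereographicChart.

(** * The conformal factor, the gradient and the boundary mean curvature in the chart *)

Section ConformallyFlat.
Context {R : realType} {m : nat}.
Variable rho : 'rV[R]_m.+1 -> R.

(* In the stereographic chart, g = exp (2 * theta) |dy|^2. *)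
Definition theta (y : 'rV[R]_m) : R := rhoc rho y + (ln 2 - ln (1 + sqn y)).

Lemma expR_rhoc y : expR (2 * rhoc rho y) * (4 / (1 + sqn y) ^+ 2) = expR (2 * theta y).
Proof.
rewrite /theta !mulrDr mulrN expRD expRB; congr (_ * _).
by rewrite !expRM_natl !lnK ?posrE ?add1_sqn_gt0//; congr (_ / _); ring.
Qed.

Lemma gcE i j y : gc rho i j y = expR (2 * theta y) * (i == j)%:R.
Proof. by rewrite /gc g0cE mulrA expR_rhoc. Qed.

Lemma g0mxE (y : 'rV[R]_m) : g0mx y = (4 / (1 + sqn y) ^+ 2)%:M.
Proof. by apply/matrixP => i j; rewrite !mxE g0cE mulr_natr. Qed.

Lemma gmxE y : gmx rho y = (expR (2 * theta y))%:M.
Proof. by apply/matrixP => i j; rewrite !mxE gcE mulr_natr. Qed.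

Lemma ginvE y : ginv rho y = (expR (- (2 * theta y)))%:M.
Proof. by rewrite /ginv gmxE invmx_scalar expRN. Qed.

Lemma grad0_sq_istereo y : grad0_sq rho (istereo y) =
  (1 + sqn y) ^+ 2 / 4 * \sum_(i < m) pd i (rhoc rho) y ^+ 2.
Proof.
rewrite /grad0_sq istereoK g0mxE invmx_scalar mulr_sumr; apply: eq_bigr => i _.
rewrite (eq_bigr (fun j => (i == j)%:R * ((1 + sqn y) ^+ 2 / 4 *
   pd i (rhoc rho) y * pd j (rhoc rho) y))); last first.
  move=> j _; rewrite mxE -[_ *+ (i == j)]mulr_natr; field; exact: add1_sqn_neq0.
by rewrite sum_deltal; ring.
Qed.

(** In the chart the round gradient of the height x_{m+1} is the field -y, so h(g) is a weighted
    radial derivative of rho. *)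
Lemma hmean_istereo y : hmean rho (istereo y) =
  expR (- rhoc rho y) * \sum_(i < m) pd i (rhoc rho) y * y 0 i.
Proof.
rewrite /hmean mxE istereoK mulNr -mulrN -/(rhoc rho y); congr (_ * _).
rewrite -sumrN; apply: eq_bigr => i _.
rewrite (eq_bigr (fun j => (i == j)%:R * ((1 + sqn y) ^+ 2 / 4 *
   pd j (rhoc rho) y * (- 4 * y 0 i / (1 + sqn y) ^+ 2)))); last first.
  move=> j _; rewrite g0mxE invmx_scalar mxE -[_ *+ (i == j)]mulr_natr pd_istereo_max.
  field; exact: add1_sqn_neq0.
by rewrite sum_deltal; field; exact: add1_sqn_neq0.
Qed.

Lemma is_derive_log_add1_sqn (y v : 'rV[R]_m) :
  is_derive y v (fun z => ln 2 - ln (1 + sqn z))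
    (- (2 / (1 + sqn y) * \sum_(i < m) v 0 i * y 0 i)).
Proof.
have d : is_derive y v (fun z : 'rV[R]_m => ln (1 + sqn z))
    ((1 + sqn y)^-1 * (2 * \sum_(i < m) v 0 i * y 0 i)).
  apply: (@is_derive_compR _ _ (@ln R)); last exact: is_derive_add1_sqn.
  exact/is_derive1_ln/add1_sqn_gt0.
apply: (is_derive_eq (is_derive_subf (is_derive_cst (ln (2 : R)) y v) d)).
by rewrite sub0r; congr (- _); rewrite mulrA [_^-1 * _]mulrC.
Qed.

Lemma differentiable_log_add1_sqn (y : 'rV[R]_m) :
  differentiable (fun z : 'rV[R]_m => ln 2 - ln (1 + sqn z)) y.
Proof.
apply: differentiableB; first exact: differentiable_cst.
apply: (@differentiable_comp _ _ _ _ (fun z : 'rV[R]_m => 1 + sqn z) (@ln R)).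
  by apply: differentiableD; [exact: differentiable_cst|exact: differentiable_sqn].
by apply/derivable1_diffP; have := is_derive1_ln (add1_sqn_gt0 y) => /@ex_derive.
Qed.

Lemma differentiable_theta y :
  differentiable (rhoc rho) y -> differentiable theta y.
Proof. by move=> d; apply: differentiableD => //; exact: differentiable_log_add1_sqn. Qed.

Lemma pd_theta y i : differentiable (rhoc rho) y ->
  pd i theta y = pd i (rhoc rho) y - 2 / (1 + sqn y) * y 0 i.
Proof.
move=> d; have dr := derivableP (@diff_derivable _ _ _ _ _ (ebasis i) d).
rewrite /pd (@derive_val _ _ _ _ _ _ _ (is_derive_addf dr (is_derive_log_add1_sqn y (ebasis i)))).
by rewrite sum_ebasis.
Qed.

Lemma differentiable_pd_theta (U : set 'rV[R]_m) y i : open U -> U y ->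
  (forall z, U z -> differentiable (rhoc rho) z) ->
  differentiable (pd i (rhoc rho)) y -> differentiable (pd i theta) y.
Proof.
move=> oU Uy dr dpr.
apply: (@near_eq_differentiable _ _ _
  (fun z => pd i (rhoc rho) z - 2 * (1 + sqn z)^-1 * z 0 i)).
  by near=> z; rewrite pd_theta//; apply: dr; near: z; exact: open_nbhs_nbhs.
apply: differentiableB => //.
apply: differentiableM; last exact: differentiable_coord.
apply: differentiableM; first exact: differentiable_cst.
apply: differentiableV; last exact: add1_sqn_neq0.
by apply: differentiableD; [exact: differentiable_cst|exact: differentiable_sqn].
Unshelve. all: by end_near. Qed.

End ConformallyFlat.

(** * Christoffel symbols, Ricci and Schouten tensors of a conformally flat metric *)

Section ConformalCurvature.
Context {R : realType} {m : nat}.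
Variables (rho : 'rV[R]_m.+1 -> R) (U : set 'rV[R]_m).
Hypothesis oU : open U.
Hypothesis dr : forall z, U z -> differentiable (rhoc rho) z.
Hypothesis dpr : forall i z, U z -> differentiable (pd i (rhoc rho)) z.

Local Notation th := (theta rho).

Lemma differentiable_theta_on z : U z -> differentiable th z.
Proof. by move=> /dr; exact: differentiable_theta. Qed.

Lemma differentiable_pd_theta_on i z : U z -> differentiable (pd i th) z.
Proof. by move=> Uz; apply: (differentiable_pd_theta oU) => //; exact: dpr. Qed.

Lemma near_U z : U z -> \forall y \near z, U y.
Proof. by move=> Uz; exact: open_nbhs_nbhs. Qed.

Lemma hess_theta_sym i j z : U z -> pd i (pd j th) z = pd j (pd i th) z.
Proof.
move=> Uz; apply: pd_comm; try exact: differentiable_pd_theta_on.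
by near=> y; apply: differentiable_theta_on; near: y; exact: near_U.
Unshelve. all: by end_near. Qed.

Lemma pd_gc k i j y : U y ->
  pd k (gc rho i j) y = 2 * expR (2 * th y) * pd k th y * (i == j)%:R.
Proof.
move=> Uy; have d := derivableP (@diff_derivable _ _ _ _ _ (ebasis k) (differentiable_theta_on Uy)).
rewrite (_ : gc rho i j = (fun z => (i == j)%:R * expR (2 * th z))); last first.
  by apply/funext => z; rewrite gcE mulrC.
rewrite /pd (@derive_val _ _ _ _ _ _ _ (is_derive_mull _ (is_derive_compR
   (is_derive_expR _) (is_derive_mull 2 d)))).
by rewrite -/(pd _ _ _); ring.
Qed.

(** The exponential in the derivatives of g cancels against the one in its inverse, so the symbols
    are linear in the gradient of theta. *)
Lemma christE k i j y : U y -> christ rho k i j y =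
  (j == k)%:R * pd i th y + (i == k)%:R * pd j th y - (i == j)%:R * pd k th y.
Proof.
move=> Uy; rewrite /christ.
rewrite (eq_bigr (fun l => (k == l)%:R * (2 *
   ((j == l)%:R * pd i th y + (i == l)%:R * pd j th y - (i == j)%:R * pd l th y)))).
  by rewrite sum_deltal mulrA mulVf ?pnatr_eq0// mul1r.
move=> l _; rewrite !pd_gc// ginvE mxE expRN -[_ *+ (k == l)]mulr_natr.
have E0 : expR (2 * th y) != 0 by rewrite gt_eqF// expR_gt0.
move: (pd i _ _) (pd j _ _) (pd l _ _) (expR _) E0 => p q s E E0.
by field.
Qed.

Lemma pd_christ p k i j y : U y -> pd p (christ rho k i j) y =
  (j == k)%:R * pd p (pd i th) y + (i == k)%:R * pd p (pd j th) y
    - (i == j)%:R * pd p (pd k th) y.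
Proof.
move=> Uy.
have d l := derivableP (@diff_derivable _ _ _ _ _ (ebasis p) (differentiable_pd_theta_on l Uy)).
rewrite /pd (@near_eq_derive _ _ _ _ (fun z => (j == k)%:R * pd i th z +
  (i == k)%:R * pd j th z - (i == j)%:R * pd k th z)); last first.
  by near=> z; apply: christE; near: z; exact: near_U.
exact: (@derive_val _ _ _ _ _ _ _ (is_derive_subf (is_derive_addf
  (is_derive_mull _ (d i)) (is_derive_mull _ (d j))) (is_derive_mull _ (d k)))).
Unshelve. all: by end_near. Qed.

Local Notation N y := (\sum_(l < m) pd l th y ^+ 2).
Local Notation lap y := (\sum_(l < m) pd l (pd l th) y).

Lemma ricciE i j y : U y -> ricci rho i j y =
  - (m%:R - 2) * pd i (pd j th) y + (m%:R - 2) * pd i th y * pd j th y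
  - (lap y + (m%:R - 2) * N y) * (i == j)%:R.
Proof.
move=> Uy; rewrite /ricci.
(* [ring] compares its atoms up to conversion, which diverges on derivatives. *)
have [T TE] : exists T, forall i, pd i th y = T i by exists (fun i => pd i th y).
have [H HE] : exists H, forall i j, pd i (pd j th) y = H i j.
  by exists (fun i j => pd i (pd j th) y).
have Hsym : H j i = H i j by rewrite -!HE (hess_theta_sym _ _ Uy).
have cE k i' j' : christ rho k i' j' y =
  (j' == k)%:R * T i' + (i' == k)%:R * T j' - (i' == j')%:R * T k by rewrite -!TE; exact: christE.
have pcE p k i' j' : pd p (christ rho k i' j') y = (j' == k)%:R * H p i'
  + (i' == k)%:R * H p j' - (i' == j')%:R * H p k by rewrite -!HE; exact: pd_christ.
under [\sum_l pd l (pd l th) y]eq_bigr do rewrite HE.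
under [\sum_l pd l th y ^+ 2]eq_bigr do rewrite TE.
rewrite !TE HE.
(* [q1] and [q2] contract the two products of Christoffel symbols over [l]; each Kronecker delta
   removes the sum. *)
have q1 k : \sum_(l < m) christ rho k k l y * christ rho l i j y =
    2 * T i * T j - (i == j)%:R * \sum_l T l ^+ 2.
  rewrite (eq_bigr (fun l => (j == l)%:R * (T i * T l) + (i == l)%:R * (T j * T l)
      - (i == j)%:R * T l ^+ 2)); last first.
    by move=> l _; rewrite !cE eqxx -[true%:R]/(1 : R) [l == k]eq_sym; ring.
  by rewrite sumrB big_split/= !sum_deltal -mulr_sumr; ring.
have q2 k : \sum_(l < m) christ rho k j l y * christ rho l i k y =
    T j * T i + (j == k)%:R * (2 * T k * T i - (i == k)%:R * \sum_l T l ^+ 2)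
    - T k * ((k == j)%:R * T i + (i == j)%:R * T k - (i == k)%:R * T j).
  rewrite (eq_bigr (fun l => (k == l)%:R * (T j * ((k == l)%:R * T i + (i == l)%:R * T k - (i == k)%:R * T l))
      + (j == k)%:R * ((k == l)%:R * (T l * T i) + (i == l)%:R * (T l * T k)
          - (i == k)%:R * T l ^+ 2)
      - (j == l)%:R * (T k * ((k == l)%:R * T i + (i == l)%:R * T k - (i == k)%:R * T l)))); last first.
    by move=> l _; rewrite !cE [l == k]eq_sym; ring.
  rewrite sumrB big_split/= !sum_deltal -mulr_sumr sumrB big_split/= !sum_deltal -mulr_sumr.
  by rewrite eqxx -[true%:R]/(1 : R); ring.
(* The summand is sorted by its Kronecker factor in [k], so that each group is summed by
   [sum_deltal], by [sum_ord_const] or into the squared gradient. *)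
rewrite (eq_bigr (fun k => ((j == k)%:R * H k i + (i == k)%:R * H k j - (i == j)%:R * H k k
   - H j i + (2 * T i * T j - (i == j)%:R * \sum_l T l ^+ 2) - T j * T i)
   - ((j == k)%:R * (2 * T k * T i - (i == k)%:R * \sum_l T l ^+ 2) - (j == k)%:R * (T k * T i))
   + (i == j)%:R * T k ^+ 2 - (i == k)%:R * (T k * T j))); last first.
  move=> k _; have := congr2 (fun a b => a - b) (q1 k) (q2 k); rewrite -sumrB => ->.
  rewrite (pcE k k i j) (pcE j k i k) eqxx -[true%:R]/(1 : R) [k == j]eq_sym.
  ring.
rewrite !(sumrB, big_split)/= !sum_deltal !sum_ord_const -!mulr_sumr Hsym.
by ring.
Qed.

Hypothesis m3 : (3 <= m)%N.

Let m1_neq0 : m%:R - 1 != 0 :> R.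
Proof. by rewrite subr_eq0 pnatr_eq1; case: eqP m3 => // ->. Qed.

Let m2_neq0 : m%:R - 2 != 0 :> R.
Proof. by rewrite subr_eq0 eqr_nat; case: eqP m3 => // ->. Qed.

Lemma scalE y : U y -> scal rho y = expR (- (2 * th y)) *
  (- 2 * (m%:R - 1) * lap y - (m%:R - 2) * (m%:R - 1) * N y).
Proof.
move=> Uy; rewrite /scal.
have [T TE] : exists T, forall i, pd i th y = T i by exists (fun i => pd i th y).
have [H HE] : exists H, forall i, pd i (pd i th) y = H i.
  by exists (fun i => pd i (pd i th) y).
under [\sum_l pd l (pd l th) y]eq_bigr do rewrite HE.
under [\sum_l pd l th y ^+ 2]eq_bigr do rewrite TE.
rewrite (eq_bigr (fun i => expR (- (2 * th y)) * (- (m%:R - 2) * H i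
    + (m%:R - 2) * T i ^+ 2 - (\sum_l H l + (m%:R - 2) * \sum_l T l ^+ 2)))); last first.
  move=> i _; rewrite (eq_bigr (fun j => (i == j)%:R * (expR (- (2 * th y)) * ricci rho i j y))).
    rewrite sum_deltal (ricciE _ _ Uy) eqxx -[true%:R]/(1 : R).
    under [\sum_l pd l (pd l th) y]eq_bigr do rewrite HE.
    under [\sum_l pd l th y ^+ 2]eq_bigr do rewrite TE.
    by rewrite HE TE; congr (_ * _); ring.
  by move=> j _; rewrite ginvE mxE -[_ *+ (i == j)]mulr_natr mulrCA mulrA.
rewrite -mulr_sumr sumrB big_split/= -!mulr_sumr sum_ord_const.
by congr (_ * _); ring.
Qed.

(** The Laplacian in the Ricci tensor cancels against the one in the scalar curvature, and the
    gradient term drops to one half. *)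
Lemma schoutenE i j y : U y -> schouten rho i j y =
  - pd i (pd j th) y + pd i th y * pd j th y - 2^-1 * N y * (i == j)%:R.
Proof.
move=> Uy; rewrite /schouten (scalE Uy) (ricciE _ _ Uy) gcE expRN.
have E0 : expR (2 * th y) != 0 by rewrite gt_eqF// expR_gt0.
move: (lap y) (N y) (pd i (pd j th) y) (pd i th y) (pd j th y) (expR _) E0.
by move=> L n H p q E E0; field; rewrite E0 m1_neq0 m2_neq0.
Qed.

Lemma gSch_istereo i j y : U y -> gSch rho (istereo y) i j = expR (- (2 * th y)) *
  (- pd i (pd j th) y + pd i th y * pd j th y - 2^-1 * N y * (i == j)%:R).
Proof.
by move=> Uy; rewrite /gSch istereoK ginvE mul_scalar_mx !mxE schoutenE.
Qed.

End ConformalCurvature.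

(** * First- and second-order conditions at a minimum *)

Section RealVariable.
Context {R : realType}.

Lemma derive_lt0_decr (h : R -> R) (d : R) : is_derive (0 : R) 1 h d -> d < 0 ->
  exists2 e, 0 < e & forall t, 0 < t < e -> h t < h 0.
Proof.
move=> [dv dE] d0.
have Q : (fun t : R => t^-1 *: ((h \o shift 0) (t *: 1) - h 0)) @ 0^' --> d.
  by rewrite -dE; exact: dv.
have /nbhs_ballP[e /= e0 He] : \forall t \near (0 : R), t != 0 ->
    t^-1 *: ((h \o shift 0) (t *: 1) - h 0) < 0.
  exact: (cvgr_lt _ Q _ d0).
exists e => // t /andP[t0 te].
have := He t; rewrite -ball_normE /ball_/= sub0r normrN gtr0_norm// => /(_ te).
rewrite gt_eqF// => /(_ isT); rewrite addr0 [t *: 1]mulr1 pmulr_rlt0 ?invr_gt0//.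
by rewrite subr_lt0.
Qed.

Lemma derive_ge0_right_min (h : R -> R) (d e : R) : 0 < e ->
  is_derive (0 : R) 1 h d -> (forall t, 0 < t < e -> h 0 <= h t) -> 0 <= d.
Proof.
move=> e0 dh hmin; rewrite leNgt; apply/negP => /(derive_lt0_decr dh)[e' e'0 He'].
pose t := Num.min e e' / 2.
have m0 : 0 < Num.min e e' by rewrite lt_min e0.
have t0 : 0 < t by rewrite divr_gt0.
have : t < Num.min e e' by rewrite /t ltr_pdivrMr// ltr_pMr// ltr1n.
rewrite lt_min => /andP[te te'].
have := hmin t; rewrite t0 te => /(_ isT); apply/negP; rewrite -ltNge.
by apply: He'; rewrite t0.
Qed.

(** If the second derivative were negative, h' would be negative just after 0, and by the mean value
    theorem h would fall below its minimum. *)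
Lemma derive2_min (h h' : R -> R) (d e : R) : 0 < e ->
  (forall t, - e < t < e -> is_derive t 1 h (h' t)) ->
  is_derive (0 : R) 1 h' d -> (forall t, - e < t < e -> h 0 <= h t) ->
  h' 0 = 0 /\ 0 <= d.
Proof.
move=> e0 dh dh' hmin.
have h00 : h' 0 = 0.
  have := @derive1_at_min _ h (- e) e 0.
  have ee : - e <= e by rewrite ltW// ltrNl (lt_trans _ e0)// oppr_lt0.
  move=> /(_ ee) H.
  have I0 : (0 : R) \in `]- e, e[%R by rewrite in_itv/= e0 oppr_lt0 e0.
  have : is_derive (0 : R) 1 h 0.
    apply: H => // t; rewrite in_itv/= => te.
    by have := dh _ te => /@ex_derive.
  move=> /@derive_val E0; rewrite -[RHS]E0; apply/esym.
  by have /dh/@derive_val : - e < 0 < e by rewrite e0 oppr_lt0 e0.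
split=> //; rewrite leNgt; apply/negP => /(derive_lt0_decr dh')[e' e'0 He'].
pose t := Num.min e e' / 2.
have m0 : 0 < Num.min e e' by rewrite lt_min e0.
have t0 : 0 < t by rewrite divr_gt0.
have : t < Num.min e e' by rewrite /t ltr_pdivrMr// ltr_pMr// ltr1n.
rewrite lt_min => /andP[te te'].
have ne0 : - e < 0 by rewrite oppr_lt0.
have [] := @MVT _ h h' _ _ t0.
- move=> s; rewrite in_itv/= => /andP[s0 st]; apply: dh.
  by rewrite (lt_trans ne0)// (lt_trans st).
- apply: derivable_within_continuous => s; rewrite in_itv/= => /andP[s0 st].
  have : - e < s < e by rewrite (lt_le_trans ne0)//= (le_lt_trans st).
  by move=> /dh/@ex_derive.
move=> s; rewrite in_itv/= => /andP[s0 st] E.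
have : h' s < 0 by rewrite -h00; apply: He'; rewrite s0 (lt_trans st).
apply/negP; rewrite -leNgt -(pmulr_lge0 _ t0) -[X in _ * X]subr0 -E subr_ge0.
by apply: hmin; rewrite te andbT (lt_trans ne0).
Qed.

End RealVariable.

(** * Orthogonal unit vectors and compact shells *)

Section EuclideanLemmas.
Context {R : realType}.

Lemma continuous_sqn n : continuous (@sqn R n).
Proof. by move=> y; apply: differentiable_continuous; exact: differentiable_sqn. Qed.

Lemma sqn_line n (y e : 'rV[R]_n) t :
  sqn (y + t *: e) = sqn y + 2 * t * (\sum_i e 0 i * y 0 i) + t ^+ 2 * sqn e.
Proof.
rewrite /sqn !mulr_sumr -!big_split/=; apply: eq_bigr => i _; rewrite !mxE; ring.
Qed.

(** A quarter turn of the first two coordinates of [y], normalized; if both vanish, the first basis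
    vector works. *)
Lemma exists_unit_orthogonal n (y : 'rV[R]_n) : (2 <= n)%N ->
  exists e : 'rV[R]_n, sqn e = 1 /\ \sum_i e 0 i * y 0 i = 0.
Proof.
case: n y => [//|[//|n]] y _.
pose i0 : 'I_n.+2 := ord0; pose i1 : 'I_n.+2 := lift ord0 ord0.
have sum2 (F : 'I_n.+2 -> R) : (forall j, F (lift ord0 (lift ord0 j)) = 0) ->
    \sum_i F i = F i0 + F i1.
  by move=> F0; rewrite !big_ord_recl big1 ?addr0.
pose a := y 0 i0; pose b := y 0 i1.
pose s := a ^+ 2 + b ^+ 2.
have [s0|s0] := eqVneq s 0.
  have /eqP := s0; rewrite paddr_eq0 ?sqr_ge0// !sqrf_eq0 => /andP[/eqP a0 _].
  exists (\row_j if j == i0 then 1 else 0); split.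
    by rewrite /sqn sum2 => [|j]; rewrite !mxE/= ?expr0n/= ?expr1n ?addr0.
  by rewrite sum2 => [|j]; rewrite !mxE/= ?mul0r ?mul1r ?addr0 -/a ?a0.
have sp : 0 < s by rewrite lt_neqAle eq_sym s0 addr_ge0 ?sqr_ge0.
pose q := (Num.sqrt s)^-1.
have q2 : q ^+ 2 * s = 1.
  by rewrite /q exprVn sqr_sqrtr ?ltW// mulVf.
exists (\row_j if j == i0 then q * b else if j == i1 then - q * a else 0); split.
  rewrite /sqn sum2 => [|j]; rewrite !mxE/= ?expr0n//.
  by rewrite -[RHS]q2 /s; ring.
by rewrite sum2 => [|j]; rewrite !mxE/= ?mul0r// -/a -/b; ring.
Qed.

Lemma compact_sqn_shell n (a b : R) :
  compact [set y : 'rV[R]_n | a <= sqn y <= b].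
Proof.
apply: bounded_closed_compact.
  exists (1 + `|b|); split; first exact: num_real.
  move=> M bM y /= /andP[_ yb]; apply: le_trans (ltW bM).
  rewrite [leLHS]/Num.norm/= mx_normrE; apply: bigmax_le => [|[i j] _] /=.
    by rewrite addr_ge0.
  rewrite (ord1 i).
  have : y 0 j ^+ 2 <= `|b|.
    rewrite (le_trans _ (ler_norm b))// (le_trans _ yb)// /sqn (bigD1 j)//=.
    by rewrite lerDl sumr_ge0// => k _; exact: sqr_ge0.
  rewrite -real_normK ?num_real//.
  have := normr_ge0 b; have := normr_ge0 (y 0 j).
  move: (`|y 0 j|) (`|b|) => u w u0 w0 uw; nra.
rewrite (_ : mkset _ = sqn @^-1` `[a, b]); last first.
  by apply/seteqP; split => y /=; rewrite in_itv.
by apply: closed_comp => [y _|]; [exact: continuous_sqn|exact: interval_closed].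
Qed.

End EuclideanLemmas.

(** * Gradient estimate and minimum principle on the shell *)

Section ShellAnalysis.
Context {R : realType} {m : nat}.
Variables (th : 'rV[R]_m -> R) (U : set 'rV[R]_m) (d2 K : R).
Hypothesis m2 : (2 <= m)%N.
Hypothesis dth : forall z, U z -> differentiable th z.
Hypothesis dpth : forall i z, U z -> differentiable (pd i th) z.
Hypothesis hess_sym : forall i j z, U z -> pd i (pd j th) z = pd j (pd i th) z.
Hypothesis d2_gt0 : 0 < d2.
Hypothesis d2_lt1 : d2 < 1.
Hypothesis shellU : forall z, d2 < sqn z <= 1 -> U z.
Hypothesis K0 : 0 <= K.

Local Notation N y := (\sum_(l < m) pd l th y ^+ 2).

(** The entries of g^-1 Sch(g) as computed in [gSch_istereo], here for an arbitrary function
    [th]. *)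
Definition sch (i j : 'I_m) (y : 'rV[R]_m) : R := expR (- (2 * th y)) *
  (- pd i (pd j th) y + pd i th y * pd j th y - 2^-1 * N y * (i == j)%:R).

Hypothesis schK : forall y, d2 < sqn y <= 1 -> \sum_i \sum_j sch i j y ^+ 2 <= K.
Hypothesis trsch : forall y, d2 < sqn y <= 1 -> 0 <= \sum_i sch i i y.
(** This is h(g) >= 0: on |y| = 1 the round factor contributes -1 to the radial derivative of
    theta. *)
Hypothesis bdry : forall y, sqn y = 1 -> -1 <= \sum_i pd i th y * y 0 i.
(** Properness in the chart: points where theta and its gradient are both bounded stay away from the
    inner sphere. *)
Hypothesis proper : forall B, exists2 tau, 0 < tau & forall y,
  d2 < sqn y <= 1 -> th y <= B -> N y <= B -> d2 + tau <= sqn y.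

Lemma hessE i j y : pd i (pd j th) y =
  - expR (2 * th y) * sch i j y + pd i th y * pd j th y - 2^-1 * N y * (i == j)%:R.
Proof.
by rewrite /sch expRN; field; rewrite gt_eqF// expR_gt0.
Qed.

Lemma sum_unit_sq (e b : 'I_m -> R) : \sum_i e i ^+ 2 = 1 ->
  \sum_i \sum_j (e i * b j) ^+ 2 = \sum_j b j ^+ 2.
Proof.
move=> e1; rewrite -[RHS]mul1r -e1 mulr_suml; apply: eq_bigr => i _.
by rewrite mulr_sumr; apply: eq_bigr => j _; rewrite exprMn.
Qed.

(** * Differential inequalities along a segment in the shell *)

Section Line.
Variables (y e : 'rV[R]_m) (T : R).
Hypothesis e1 : sqn e = 1.
Hypothesis T0 : 0 <= T.
Hypothesis line : forall t, 0 <= t <= T -> d2 < sqn (y + t *: e) <= 1.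

Local Notation z t := (y + t *: e).
Let a t := th (z t).
Let p t := \sum_i e 0 i * pd i th (z t).

Let lineU t : 0 <= t <= T -> U (z t).
Proof. by move=> /line/shellU. Qed.

Let da t : 0 <= t <= T -> is_derive t 1 a (p t).
Proof. by move=> /lineU/dth d; exact: is_derive_line. Qed.

Let see t := \sum_i \sum_j sch i j (z t) * (e 0 i * e 0 j).

(** The second derivative of theta along the line, with the Hessian expressed through [sch]. *)
Let dp t : 0 <= t <= T ->
  is_derive t 1 p (- expR (2 * a t) * see t + p t ^+ 2 - 2^-1 * N (z t)).
Proof.
move=> tT; have Ut := lineU tT.
have -> : - expR (2 * a t) * see t + p t ^+ 2 - 2^-1 * N (z t) =
    \sum_i e 0 i * \sum_j e 0 j * pd j (pd i th) (z t).
  have [n nE] : exists n, n = N (z t) by eexists.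
  rewrite -nE (_ : 2^-1 * n = 2^-1 * n * sqn e); last by rewrite e1 mulr1.
  rewrite /see expr2 {1}/p mulr_suml !mulr_sumr -big_split -sumrB/=.
  apply: eq_bigr => i _.
  rewrite [X in _ - X](_ : _ =
      \sum_j (i == j)%:R * (2^-1 * n * e 0 i * e 0 j)); last first.
    by rewrite sum_deltal; ring.
  rewrite /p !mulr_sumr -big_split -sumrB/=.
  by apply: eq_bigr => j _; rewrite (hess_sym j i)// hessE -/(a t) -nE; ring.
rewrite (_ : p = \sum_i (fun t => e 0 i * pd i th (z t))); last first.
  by apply/funext => s; rewrite fct_sumE.
by apply: is_derive_sum => i; apply: is_derive_mull; apply: is_derive_line; exact: dpth.
Qed.

Let see_ge t : 0 <= t <= T -> - (K + 1) <= 2 * see t.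
Proof.
move=> tT; have := sum_prod_le (fun i j => sch i j (z t)) (fun i j => e 0 i * e 0 j).
rewrite sum_unit_sq// -/(sqn e) e1 -/(see t) => /ler_normlP[h _].
by have := schK (line tT); move: h; lra.
Qed.

Let v t := expR (- 2 * a t).

Let dv t : 0 <= t <= T -> is_derive t 1 v (- 2 * p t * v t).
Proof.
move=> tT; have := is_derive_compR (is_derive_expR _) (is_derive_mull (- 2) (da tT)).
by rewrite -/(v t) mulrC.
Qed.

(* (u^2)'' is bounded below along lines, where u = exp (- theta). *)
Lemma expN2theta_line_ge t : 0 <= t <= T -> p 0 <= 0 ->
  v 0 - (K + 1) / 2 * t ^+ 2 <= v t.
Proof.
move=> /andP[t0 tT] p0.
have inT s : 0 <= s <= t -> 0 <= s <= T.
  by move=> /andP[-> st]; rewrite (le_trans st).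
have v_gt0 s : 0 < v s by exact: expR_gt0.
(* [g] is v' + (K + 1) s. Since v'' = 2 see + (2 p^2 + N) v >= -(K + 1), it is nondecreasing, and
   g(0) >= 0 by the sign of [p 0]. *)
pose g s := - 2 * p s * v s + (K + 1) * s.
have dg s : 0 <= s <= T -> is_derive s 1 g (2 * see s + (2 * p s ^+ 2 + N (z s)) * v s + (K + 1)).
  move=> sT.
  have d1 := is_derive_mulf (is_derive_mull (- 2) (dp sT)) (dv sT).
  have d2' := is_derive_mull (K + 1) (is_derive_id s 1).
  apply: (is_derive_eq (is_derive_addf d1 d2')).
  have vE : expR (2 * a s) * v s = 1 by rewrite -expRD mulNr subrr expR0.
  have -> : 2 * see s = 2 * see s * (expR (2 * a s) * v s) by rewrite vE mulr1.
  by field.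
have gge s : 0 <= s <= T -> 0 <= g s.
  move=> /andP[s0 sT].
  have : g 0 <= g s.
    apply: (nondecreasing_derive s0) => r /andP[r0 rs].
      by apply: dg; rewrite r0 (le_trans rs).
    have rT : 0 <= r <= T by rewrite r0 (le_trans rs).
    have N0 : 0 <= N (z r) by apply: sumr_ge0 => i _; exact: sqr_ge0.
    have := see_ge rT; have : 0 <= (2 * p r ^+ 2 + N (z r)) * v r.
      by apply: mulr_ge0; [rewrite addr_ge0// mulr_ge0// sqr_ge0|exact: ltW].
    lra.
  apply: le_trans; rewrite /g mulr0 addr0; apply: mulr_ge0; last exact: ltW.
  by rewrite mulNr oppr_ge0 pmulr_rle0.
have : v 0 + (K + 1) / 2 * 0 ^+ 2 <= v t + (K + 1) / 2 * t ^+ 2.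
  apply: (@nondecreasing_derive _ (fun s => v s + (K + 1) / 2 * s ^+ 2) g _ _ t0).
    move=> s /inT sT.
    have dd := is_derive_mull ((K + 1) / 2) (is_deriveX 2 (is_derive_id s 1)).
    apply: (is_derive_eq (is_derive_addf (dv sT) dd)).
    by rewrite /g expr1 /GRing.scale/=; field.
  by move=> s /inT; exact: gge.
by rewrite expr0n/= mulr0 addr0 lerBlDr.
Qed.

Let P t := expR (- a t) * N (z t).
Let seg t := \sum_i \sum_j sch i j (z t) * (e 0 i * pd j th (z t)).

(** The gradient terms give N' = p N - 2 exp(2a) seg, and the weight exp(-a) is chosen to cancel p
    N; what is left is controlled by [sch]. *)
Let dP t : 0 <= t <= T -> is_derive t 1 P (- 2 * expR (a t) * seg t).
Proof.
move=> tT; have Ut := lineU tT.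
have dN : is_derive t 1 (fun t => N (z t))
    (\sum_l 2 * pd l th (z t) * \sum_i e 0 i * pd i (pd l th) (z t)).
  rewrite (_ : (fun _ => _) = \sum_l (fun t => pd l th (z t) ^+ 2)); last first.
    by apply/funext => s; rewrite fct_sumE.
  apply: is_derive_sum => l.
  have dl := is_derive_line (dpth l Ut).
  by apply: (is_derive_eq (is_deriveX 2 dl)); rewrite expr1 /GRing.scale/=.
have dE := is_derive_compR (is_derive_expR _) (is_derive_mull (- 1) (da tT)).
rewrite (_ : P = fun s => expR (- 1 * a s) * N (z s)); last first.
  by apply/funext => s; rewrite mulN1r.
apply: (is_derive_eq (is_derive_mulf dE dN)).
have -> : \sum_l 2 * pd l th (z t) * \sum_i e 0 i * pd i (pd l th) (z t) =
    - 2 * expR (2 * a t) * seg t + p t * N (z t).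
  have [n nE] : exists n, n = N (z t) by eexists.
  rewrite -nE (_ : p t * n = 2 * (p t * n) - \sum_i e 0 i * n * pd i th (z t)); last first.
    rewrite [X in _ - X](_ : _ = p t * n); first by ring.
    by rewrite /p mulr_suml; apply: eq_bigr => i _; ring.
  rewrite (eq_bigr (fun l => \sum_i 2 * pd l th (z t) * (e 0 i * pd i (pd l th) (z t)))); last first.
    by move=> l _; rewrite mulr_sumr.
  rewrite exchange_big/=.
  have -> : p t * n = \sum_i \sum_l e 0 i * pd i th (z t) * pd l th (z t) ^+ 2.
    by rewrite nE /p mulr_suml; apply: eq_bigr => i _; rewrite mulr_sumr.
  rewrite /seg !mulr_sumr addrA -big_split -sumrB/=.
  apply: eq_bigr => i _.
  rewrite [X in _ - X](_ : _ = \sum_l (i == l)%:R * (e 0 i * n * pd l th (z t))); last first.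
    by rewrite sum_deltal.
  rewrite !mulr_sumr -big_split -sumrB/=; apply: eq_bigr => l _.
  by rewrite hessE -/(a t) -nE; field.
have -> : expR (- 1 * a t) = (expR (a t))^-1 by rewrite mulN1r expRN.
have -> : expR (2 * a t) = expR (a t) ^+ 2 by rewrite expRM_natl.
by field; rewrite gt_eqF// expR_gt0.
Qed.

(** A Gronwall argument, bounding the start by the end: 2 exp(a) seg <= exp(a) K + exp(2a) P <= D (1
    + P), so exp(D s) (1 + P) is nondecreasing. *)
Lemma gradient_line_le (L : R) : (forall t, 0 <= t <= T -> expR (2 * a t) <= L) ->
  1 + P 0 <= expR ((1 + L) * (1 + K) * T) * (1 + P T).
Proof.
move=> aL; set D := (1 + L) * (1 + K).
have P0 s : 0 <= P s.
  by rewrite mulr_ge0 ?expR_ge0// sumr_ge0// => i _; exact: sqr_ge0.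
have : expR (D * 0) * (1 + P 0) <= expR (D * T) * (1 + P T).
  apply: (@nondecreasing_derive _ (fun s => expR (D * s) * (1 + P s))
     (fun s => expR (D * s) * (D * (1 + P s) - 2 * expR (a s) * seg s)) _ _ T0).
    move=> s sT.
    have dE := is_derive_compR (is_derive_expR _) (is_derive_mull D (is_derive_id s 1)).
    have d1 := is_derive_addf (is_derive_cst (1 : R) s 1) (dP sT).
    by apply: (is_derive_eq (is_derive_mulf dE d1)); rewrite /=; ring.
  move=> s sT; rewrite mulr_ge0 ?expR_ge0//.
  have := sum_prod_le (fun i j => sch i j (z s)) (fun i j => e 0 i * pd j th (z s)).
  rewrite sum_unit_sq// -/(seg s) => /ler_normlP[_ h].
  have E0 : 0 < expR (a s) by exact: expR_gt0.
  have EL : expR (a s) ^+ 2 <= L by rewrite -expRM_natl; exact: aL.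
  have NE : N (z s) = expR (a s) * P s.
    by rewrite /P mulrA expRN mulfV ?mul1r// gt_eqF.
  have h2 : 2 * seg s <= K + expR (a s) * P s.
    by rewrite -NE; have := schK (line sT); move: h; lra.
  have : expR (a s) * (2 * seg s) <= expR (a s) * (K + expR (a s) * P s).
    by rewrite ler_pM2l.
  have EL1 : expR (a s) <= 1 + L by nra.
  have : expR (a s) * K <= (1 + L) * K by rewrite ler_wpM2r.
  have : expR (a s) ^+ 2 * P s <= L * P s by rewrite ler_wpM2r.
  have L0 : 0 <= L by rewrite (le_trans _ EL)// sqr_ge0.
  have : 0 <= K * P s by exact: mulr_ge0.
  have : 0 <= L * (K * P s) by apply: mulr_ge0 => //; exact: mulr_ge0.
  have := P0 s; rewrite /D; move: (seg s) (P s) (expR (a s)) L0 => S Q E L0.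
  by rewrite !expr2; lra.
by rewrite mulr0 expR0 mul1r.
Qed.

End Line.

Lemma shell_bound (tau : R) : 0 < tau -> exists2 B, 0 <= B &
  forall y, d2 + tau <= sqn y <= 1 -> expR (- th y) * N y <= B.
Proof.
move=> tau0; set A := [set y : 'rV[R]_m | d2 + tau <= sqn y <= 1].
have AU y : A y -> U y.
  by move=> /andP[h1 h2]; apply: shellU; rewrite h2 andbT (lt_le_trans _ h1)// ltrDl.
have [[y0 Ay0]|A0] := pselect (A !=set0); last first.
  (* For large [tau] the shell may be empty, and then any bound serves. *)
  by exists 0 => // y Ay; exfalso; apply: A0; exists y.
have [] := @compact_EVT_max _ R (fun y => expR (- th y) * N y) A.
- by exists y0.
- exact: compact_sqn_shell.
- apply: continuous_in_subspaceT => y /set_mem/AU Uy.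
  apply: differentiable_continuous; apply: differentiableM.
    apply: (@differentiable_comp _ _ _ _ (fun y => - th y) (@expR R)).
      by apply: differentiableN; exact: dth.
    by apply/derivable1_diffP; exact: derivable_expR.
  rewrite (_ : (fun _ => _) = \sum_l ((pd l th) * (pd l th))); last first.
    by apply/funext => s; rewrite fct_sumE; apply: eq_bigr => l _; rewrite expr2.
  by apply: differentiable_sum => l; apply: differentiableM; exact: dpth.
move=> c cA Hc; exists (expR (- th c) * N c).
  by rewrite mulr_ge0 ?expR_ge0// sumr_ge0// => i _; exact: sqr_ge0.
by move=> y Ay; apply: Hc; exact/mem_set.
Qed.

(** Near the inner sphere a tangential segment of length [T] leads to a compact shell, where [P] is
    bounded; the estimate is carried back to [y] along it. *)
Lemma gradient_bound (B : R) : exists B', forall y,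
  d2 < sqn y <= 1 -> th y <= B -> N y <= B'.
Proof.
pose w := expR (- 2 * B).
have w0 : 0 < w by exact: expR_gt0.
have K1 : 0 < K + 1 by rewrite ltr_wpDl.
(* The first bound keeps exp(-2 theta) >= w / 2 along the segment; the second keeps a segment
   starting at |y|^2 < d2 + T2 inside the unit ball. *)
pose T2 := Num.min (w / (K + 1)) ((1 - d2) / 2).
have T20 : 0 < T2 by rewrite lt_min !divr_gt0// subr_gt0.
pose T := Num.sqrt T2.
have T0 : 0 <= T by exact: sqrtr_ge0.
have TE : T ^+ 2 = T2 by rewrite sqr_sqrtr// ltW.
have [B1 B10 HB1] := shell_bound T20.
pose L := 2 * expR (2 * B).
pose B2 := expR ((1 + L) * (1 + K) * T) * (1 + B1).
exists (expR B * (B1 + B2)) => y yO yB.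
have B20 : 0 <= B2 by rewrite mulr_ge0 ?expR_ge0// addr_ge0.
have N0 z : 0 <= N z by apply: sumr_ge0 => i _; exact: sqr_ge0.
have NP z : N z = expR (th z) * (expR (- th z) * N z).
  by rewrite mulrA expRN mulfV ?mul1r// gt_eqF// expR_gt0.
suff PB : expR (- th y) * N y <= B1 + B2.
  rewrite NP; apply: ler_pM => //; first by rewrite mulr_ge0 ?expR_ge0.
  by rewrite ler_expR.
have [yT|yT] := leP (d2 + T2) (sqn y).
  rewrite (le_trans (HB1 y _)) ?lerDl//.
  by rewrite yT; case/andP: yO.
have [e0 [e01 e0y]] := exists_unit_orthogonal y m2.
have [e [e1 ey p0]] : exists e : 'rV[R]_m, [/\ sqn e = 1, \sum_i e 0 i * y 0 i = 0 &
    \sum_i e 0 i * pd i th y <= 0].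
  (* Replacing [e0] by its opposite keeps it orthogonal to [y] and makes theta initially
     nonincreasing. *)
  have [h|/ltW h] := leP (\sum_i e0 0 i * pd i th y) 0; first by exists e0.
  exists (- e0); split.
  - by rewrite -e01 /sqn; apply: eq_bigr => i _; rewrite mxE sqrrN.
  - by rewrite -[RHS]oppr0 -[in RHS]e0y -sumrN; apply: eq_bigr => i _; rewrite mxE mulNr.
  - rewrite -oppr_ge0 -sumrN (le_trans h)// le_eqVlt; apply/orP; left; apply/eqP.
    by apply: eq_bigr => i _; rewrite mxE mulNr opprK.
have sl t : sqn (y + t *: e) = sqn y + t ^+ 2.
  by rewrite sqn_line ey e1 mulr0 addr0 mulr1.
have tT2 t : 0 <= t <= T -> t ^+ 2 <= T2.
  by move=> /andP[t0 tT]; rewrite -TE lerXn2r// nnegrE.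
have line t : 0 <= t <= T -> d2 < sqn (y + t *: e) <= 1.
  move=> /tT2 tT; rewrite sl; case/andP: yO => y1 y2.
  have : T2 <= (1 - d2) / 2 by rewrite ge_min lexx orbT.
  by have := sqr_ge0 t => t2 h; apply/andP; split; lra.
have z0 : y + 0 *: e = y by rewrite scale0r addr0.
have aL t : 0 <= t <= T -> expR (2 * th (y + t *: e)) <= L.
  move=> tT; have := expN2theta_line_ge e1 line tT.
  rewrite z0 => /(_ p0) h.
  have : w <= expR (- 2 * th y) by rewrite ler_expR ler_nM2l.
  have : (K + 1) / 2 * t ^+ 2 <= w / 2.
    have : t ^+ 2 <= w / (K + 1) by rewrite (le_trans (tT2 _ tT))// ge_min lexx.
    by rewrite ler_pdivlMr// => hh; lra.
  move=> h1 h2; have h3 : w / 2 <= expR (- 2 * th (y + t *: e)) by lra.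
  rewrite -[2 * th _]opprK expRN -mulNr /L.
  have -> : 2 * expR (2 * B) = (w / 2)^-1 by rewrite invfM invrK /w mulNr expRN invrK mulrC.
  by rewrite lef_pV2// posrE ?divr_gt0// expR_gt0.
have := gradient_line_le e1 T0 line aL; rewrite z0 => h.
(* The segment ends at squared radius |y|^2 + T2 >= d2 + T2, in the shell where [B1] applies. *)
have : 1 + expR (- th (y + T *: e)) * N (y + T *: e) <= 1 + B1.
  rewrite lerD2l; apply: HB1; rewrite sl TE lerD2r.
  have TT : 0 <= T <= T by rewrite T0 lexx.
  by have /andP[_] := line T TT; rewrite sl TE => ->; case/andP: yO => /ltW ->.
move=> hB; have : expR ((1 + L) * (1 + K) * T) * (1 + expR (- th (y + T *: e)) * N (y + T *: e)) <= B2.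
  by rewrite ler_pM2l// expR_gt0.
by move: h; lra.
Qed.

Lemma theta_proper (B : R) : exists2 tau, 0 < tau & forall y,
  d2 < sqn y <= 1 -> th y <= B -> d2 + tau <= sqn y.
Proof.
have [B' HB'] := gradient_bound B.
have [tau tau0 H] := proper (Num.max B B').
exists tau => // y yO yB; apply: H => //; first by rewrite le_max yB.
by rewrite le_max HB' ?orbT.
Qed.

(** * Comparison with a hyperbolic metric *)

Let eta y := th y + ln (sqn y - d2 / 2).

Let deta y v : U y -> d2 < sqn y -> is_derive y v eta
  (\sum_i v 0 i * (pd i th y + 2 / (sqn y - d2 / 2) * y 0 i)).
Proof.
move=> Uy Sy.
have w0 : 0 < sqn y - d2 / 2 by move: d2_gt0 Sy; lra.
have d1 := derivableP (@diff_derivable _ _ _ _ _ v (dth Uy)).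
have ds := is_derive_subf (is_derive_sqn y v) (is_derive_cst (d2 / 2) y v).
have d3 := @is_derive_compR _ _ (@ln R) (fun z => sqn z - d2 / 2) _ _ _ _ (is_derive1_ln w0) ds.
apply: (is_derive_eq (is_derive_addf d1 d3)).
rewrite derive_sum_pd; last exact: dth.
rewrite subr0 !mulr_sumr -big_split/=; apply: eq_bigr => i _; ring.
Qed.

Let exists_sqn1 : exists y : 'rV[R]_m, sqn y = 1.
Proof. by have [e [e1 _]] := exists_unit_orthogonal (0 : 'rV[R]_m) m2; exists e. Qed.

(** Shifting by d2 / 2 instead of d2 keeps the logarithm bounded below on the shell, so [eta] still
    tends to +oo at the inner sphere. *)
Let ln_shift_ge (y : 'rV[R]_m) : d2 < sqn y -> ln (d2 / 2) <= ln (sqn y - d2 / 2).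
Proof. by move=> Sy; rewrite ler_ln ?posrE; move: d2_gt0 Sy; lra. Qed.

Let exists_min_eta : exists2 y, d2 < sqn y <= 1 &
  forall x, d2 < sqn x <= 1 -> eta y <= eta x.
Proof.
have [y0 y01] := exists_sqn1.
have y0O : d2 < sqn y0 <= 1 by rewrite y01 d2_lt1 lexx.
(* If theta(x) > B then eta(x) > eta(y0), so the minimum over the compact shell [A] is global. *)
pose B := eta y0 - ln (d2 / 2).
have [tau tau0 Htau] := theta_proper B.
set A := [set y : 'rV[R]_m | d2 + tau <= sqn y <= 1].
have AO y : A y -> d2 < sqn y <= 1.
  by move=> /andP[h1 h2]; rewrite h2 andbT (lt_le_trans _ h1)// ltrDl.
have Ay0 : A y0.
  rewrite /A/= y01 lexx andbT -y01; apply: Htau => //.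
  by rewrite /B /eta -addrA lerDl subr_ge0 ln_shift_ge//; case/andP: y0O.
have [] := @compact_EVT_min _ R eta A.
- by exists y0.
- exact: compact_sqn_shell.
- apply: continuous_in_subspaceT => y /set_mem/AO yO.
  have w0 : 0 < sqn y - d2 / 2 by case/andP: yO => h _; move: d2_gt0 h; lra.
  apply: differentiable_continuous; apply: differentiableD; first exact/dth/shellU.
  apply: (@differentiable_comp _ _ _ _ (fun y => sqn y - d2 / 2) (@ln R)).
    by apply: differentiableB; [exact: differentiable_sqn|exact: differentiable_cst].
  by apply/derivable1_diffP; have := is_derive1_ln w0 => /@ex_derive.
move=> c /set_mem cA Hc; exists c; first exact: AO.
move=> x xO; have [xA|xA] := pselect (A x); first by apply: Hc; exact/mem_set.
apply: (@le_trans _ _ (eta y0)); first by apply: Hc; exact/mem_set.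
have thx : B < th x.
  rewrite ltNge; apply/negP => thB; apply: xA; rewrite /A/= Htau//.
  by case/andP: xO.
have := ln_shift_ge (proj1 (andP xO)); move: thx; rewrite /B -[eta x]/(th x + ln (sqn x - d2 / 2)).
move: (eta y0) (ln _) (ln _) => *; lra.
Qed.

(* exp (- theta) / (sqn - d2 / 2) would attain its maximum, but the hyperbolic
   metric it is compared with has negative Schouten tensor. *)
Lemma shell_contradiction : False.
Proof.
have [y yO ymin] := exists_min_eta.
have /andP[y1 y2] := yO.
have Uy := shellU yO.
set w := sqn y - d2 / 2.
have w0 : 0 < w by move: d2_gt0 y1; rewrite /w; lra.
have [yb|yb] := eqVneq (sqn y) 1.
  (* At a boundary minimum only the inward direction -y is available, which gives a one-sided
     condition. *)
  have dh : is_derive (0 : R) 1 (fun t : R => eta (y + t *: (- y)))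
      (- (\sum_i pd i th y * y 0 i + 2 / w * sqn y)).
    have := deta (- y) Uy y1; move=> /is_derive_lineP.
    rewrite (_ : (fun h : R => _) = (fun t : R => eta (y + t *: (- y)))); last first.
      by apply/funext => t; rewrite addrC.
    move=> D; apply: (is_derive_eq D); rewrite {2}/sqn mulr_sumr -big_split -sumrN/=.
    by apply: eq_bigr => i _; rewrite mxE -/w; ring.
  have : 0 <= - (\sum_i pd i th y * y 0 i + 2 / w * sqn y).
    apply: (derive_ge0_right_min _ dh (e := (1 - d2) / 2)).
      by rewrite divr_gt0// subr_gt0.
    move=> t /andP[t0 te]; rewrite scale0r addr0; apply: ymin.
    rewrite sqn_line.
    have -> : sqn (- y) = 1 by rewrite -yb /sqn; apply: eq_bigr => i _; rewrite mxE sqrrN.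
    rewrite [X in 2 * t * X](_ : _ = -1); last first.
      by rewrite -yb /sqn -sumrN; apply: eq_bigr => i _; rewrite mxE expr2 mulNr.
    rewrite yb mulr1 mulrN1 -subr_gt0 -[_ <= 1]subr_ge0.
    move: t te t0 d2_gt0 => s st s0 dd; apply/andP; split; nra.
  have := bdry yb; rewrite yb mulr1.
  (* Here w = 1 - d2 / 2 < 1, so the radial derivative of theta would be below -2, against
     [bdry]. *)
  have : 2 < 2 / w by rewrite ltr_pdivlMr// /w yb; move: d2_gt0; lra.
  lra.
have y3 : sqn y < 1 by rewrite lt_neqAle yb.
(* First- and second-order conditions for [eta] along each coordinate axis at an interior
   minimum. *)
have Hi i : pd i th y + 2 / w * y 0 i = 0 /\
    0 <= pd i (pd i th) y + 2 / w - 4 * y 0 i ^+ 2 / w ^+ 2.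
  have zS t : sqn (y + t *: ebasis i) = sqn y + 2 * t * y 0 i + t ^+ 2.
    rewrite sqn_line sum_ebasis.
    have -> : sqn (ebasis i : 'rV[R]_m) = 1.
      rewrite /sqn -[RHS](sum_deltal i (fun => 1)); apply: eq_bigr => j _.
      by rewrite mxE mulr1; case: (i == j); rewrite ?expr1n ?expr0n.
    by rewrite mulr1.
  have [e e0 He] : exists2 e, 0 < e & forall t, - e < t < e ->
      d2 < sqn (y + t *: ebasis i) < 1.
    pose q := 2 * `|y 0 i| + 1.
    have q0 : 0 < q by rewrite ltr_wpDl// mulr_ge0.
    pose g := Num.min (sqn y - d2) (1 - sqn y).
    have g0 : 0 < g by rewrite lt_min !subr_gt0 y1.
    exists (Num.min 1 (g / q)); first by rewrite lt_min ltr01 divr_gt0.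
    move=> t; rewrite -ltr_norml lt_min ltr_pdivlMr// => /andP[t1 tg].
    rewrite zS -addrA.
    have : `|2 * t * y 0 i + t ^+ 2| < g.
      rewrite (le_lt_trans (ler_normD _ _))// (le_lt_trans _ tg)//.
      rewrite /q mulrDr mulr1 !normrM (ger0_norm (ler0n _ 2)).
      have := normr_ge0 t; move: (`|t|) (`|y 0 i|) t1 => a b; nra.
    rewrite ltr_norml lt_min => /andP[h1 /andP[h2 h3]].
    by move: h1; rewrite /g ltrNl lt_min => /andP[h4 h5]; apply/andP; split; lra.
  have zO t : - e < t < e -> d2 < sqn (y + t *: ebasis i) <= 1.
    by move=> /He /andP[-> /ltW].
  pose h t := eta (y + t *: ebasis i).
  pose h' t := pd i th (y + t *: ebasis i) +
    2 * (sqn (y + t *: ebasis i) - d2 / 2)^-1 * (y + t *: ebasis i) 0 i.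
  have e00 : - e < 0 < e by rewrite oppr_lt0 e0.
  have z0 : y + 0 *: ebasis i = y by rewrite scale0r addr0.
  have dh t : - e < t < e -> is_derive t 1 h (h' t).
    move=> te; have /andP[zt _] := zO _ te.
    have := deta (ebasis i) (shellU (zO _ te)) zt.
    rewrite sum_ebasis => /is_derive_lineP D; apply/is_derive_lineP.
    rewrite (_ : (fun h0 : R => _) = (fun h0 : R => eta (h0 *: ebasis i + (y + t *: ebasis i)))) //.
    by apply/funext => s; rewrite /h [s *: 1]mulr1 scalerDl addrCA.
  have dh' : is_derive (0 : R) 1 h'
      (pd i (pd i th) y + 2 / w - 4 * y 0 i ^+ 2 / w ^+ 2).
    have Uz : U (y + 0 *: ebasis i) by rewrite z0.
    have D1 := is_derive_line (dpth i Uz).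
    have D2 := is_derive_line (differentiable_sqn (y + 0 *: ebasis i)).
    have D3 := is_derive_line (differentiable_coord (y + 0 *: ebasis i) 0 i).
    rewrite !sum_ebasis z0 in D1 D2 D3.
    have Dw := is_derive_subf D2 (is_derive_cst (d2 / 2) (0 : R) 1).
    have wn0 : sqn (y + 0 *: ebasis i) - d2 / 2 != 0 by rewrite z0 gt_eqF.
    have Di := @is_deriveV R (fun t => sqn (y + t *: ebasis i) - d2 / 2) _ _ _ wn0 Dw.
    apply: (is_derive_eq (is_derive_addf D1 (is_derive_mulf (is_derive_mull 2 Di) D3))).
    have -> : pd i (fun z : 'rV[R]_m => z 0 i) y = 1.
      rewrite /pd (@derive_val _ _ _ _ _ _ _ (is_derive_coord y (ebasis i) i)).
      by rewrite mxE eqxx.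
    rewrite z0 -/w pd_sqn /GRing.scale/=; field.
    by rewrite gt_eqF.
  have [|h00 hd] := derive2_min e0 dh dh'.
    by move=> t te; rewrite /h z0; apply: ymin; exact: zO.
  by move: h00; rewrite /h' z0 -/w.
have lapE : 0 <= \sum_i (pd i (pd i th) y + 2 / w - 4 * y 0 i ^+ 2 / w ^+ 2).
  by apply: sumr_ge0 => i _; case: (Hi i).
have NE : N y = 4 * sqn y / w ^+ 2.
  rewrite /sqn mulr_sumr mulr_suml; apply: eq_bigr => i _.
  have [/eqP + _] := Hi i; rewrite addr_eq0 => /eqP ->.
  by field; rewrite gt_eqF.
have lapE' : 0 <= \sum_i pd i (pd i th) y + m%:R * (2 / w) - N y.
  move: lapE; rewrite sumrB big_split/= sum_ord_const.
  by rewrite NE -mulr_suml -mulr_sumr.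
have trE : 0 <= - \sum_i pd i (pd i th) y + N y - m%:R * (2^-1 * N y).
  have := trsch yO; rewrite /sch -mulr_sumr pmulr_rge0 ?expR_gt0//.
  rewrite (eq_bigr (fun i => - pd i (pd i th) y + pd i th y ^+ 2 - 2^-1 * N y)).
    by rewrite sumrB big_split/= sumrN sum_ord_const.
  by move=> i _; rewrite eqxx mulr1 expr2.
have m0 : 0 < m%:R :> R by rewrite ltr0n (leq_trans _ m2).
(* Adding the two inequalities eliminates the Laplacian. With N = 4 |y|^2 / w^2 the bracket equals
   -d2 / w^2 < 0. *)
have : 0 <= m%:R * (2 / w - 2^-1 * N y) by move: lapE' trE; lra.
rewrite pmulr_rge0// NE.
have -> : 2 / w - 2^-1 * (4 * sqn y / w ^+ 2) = 2 * (w - sqn y) / w ^+ 2.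
  by field; rewrite gt_eqF.
rewrite pmulr_lge0 ?invr_gt0 ?exprn_gt0// pmulr_rge0// /w.
by move: d2_gt0; lra.
Qed.

End ShellAnalysis.

(** * The annulus seen in the chart *)

Section Annulus.
Context {R : realType} {m : nat}.

Lemma annulusP (r : R) (x : 'rV[R]_m.+1) : 0 < r -> r < pi / 2 -> sphere m x ->
  annulus m r x <-> 0 <= x 0 ord_max < cos r.
Proof.
move=> r0 rpi Sx.
have x2 : x 0 ord_max ^+ 2 <= 1.
  have <- : sqn x = 1 by [].
  by rewrite /sqn (bigD1 ord_max)//= lerDl sumr_ge0// => i _; exact: sqr_ge0.
have x1 : -1 <= x 0 ord_max <= 1 by apply/andP; split; nra.
have p0 : 0 < pi :> R by exact: pi_gt0.
have rI : r \in `[0, pi]%R by rewrite in_itv/= ltW//=; move: rpi p0; lra.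
have hI : (pi / 2 : R) \in `[0, pi]%R by rewrite in_itv/=; apply/andP; split; move: p0; lra.
have aI : acos (x 0 ord_max) \in `[0, pi]%R by rewrite in_itv/= acos_ge0// acos_lepi.
have xE : cos (acos (x 0 ord_max)) = x 0 ord_max by apply: acosK; rewrite in_itv.
rewrite /annulus/= /dist_north.
rewrite -(ltr_cos rI aI) [acos _ <= _]leNgt -(ltr_cos hI aI) xE cos_pihalf -leNgt.
by split=> [[_ [-> ->]]//|/andP[-> ->]].
Qed.

(** (1 - cos r) / (1 + cos r) = tan^2(r / 2) is the squared radius of the image of the circle at
    distance r from the pole. *)
Lemma annulus_istereo (r : R) (y : 'rV[R]_m) : 0 < r -> r < pi / 2 ->
  annulus m r (istereo y) <-> (1 - cos r) / (1 + cos r) < sqn y <= 1.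
Proof.
move=> r0 rpi; rewrite annulusP//; last exact: sphere_istereo.
rewrite istereo_max.
have k0 : 0 < cos r by apply: cos_gt0_pihalf; rewrite rpi andbT; move: r0 rpi; lra.
have S0 := add1_sqn_gt0 y.
rewrite pmulr_lge0 ?invr_gt0// subr_ge0 ltr_pdivrMr// ltr_pdivrMr ?addr_gt0//.
by split=> /andP[h1 h2]; apply/andP; split; move: h1 h2; lra.
Qed.

End Annulus.

(** The closed half-space of nonnegative sum contains the cone, hence its closure. This yields the
    sign of the trace of g^-1 Sch(g). *)
Lemma closure_sum_ge0 (R : realType) (n : nat) (Ga : set 'rV[R]_n) (l : 'rV[R]_n) :
  (forall a, Ga a -> 0 < \sum_i a 0 i) -> closure Ga l -> 0 <= \sum_i l 0 i.
Proof.
move=> Ga0.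
have cl : closed ((fun a : 'rV[R]_n => \sum_i a 0 i) @^-1` [set t | 0 <= t]).
  apply: closed_comp => [a _|]; last exact: closed_ge.
  apply: differentiable_continuous.
  rewrite (_ : (fun _ => _) = \sum_i (fun a : 'rV[R]_n => a 0 i)); last first.
    by apply/funext => s; rewrite fct_sumE.
  by apply: differentiable_sum => i; exact: differentiable_coord.
have sub : Ga `<=` (fun a : 'rV[R]_n => \sum_i a 0 i) @^-1` [set t | 0 <= t].
  by move=> a /Ga0 /ltW.
by move=> /(closure_subset sub); rewrite -(closure_id _).1.
Qed.

(** * Transfer of the hypotheses from the sphere to the shell *)

Theorem mainTheorem19 (R : realType) (m : nat) (r c alpha : R)
    (f : 'rV[R]_m -> R) (Ga : set 'rV[R]_m) (rho : 'rV[R]_m.+1 -> R) :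
  (3 <= m)%N ->
  0 < r -> r < pi / 2 ->
  0 <= c ->
  0 < alpha -> alpha < 1 ->
  elliptic_data f Ga ->
  (* rho in C^{2,alpha}(A(r,pi/2]), expressed in the stereographic chart *)
  (exists U : set 'rV[R]_m, open U /\ stereo @` annulus m r `<=` U /\
     C2alpha_loc alpha U (rhoc rho)) ->
  (* f(lambda(g)) = 0 and lambda(g) in closure Gamma on A(r,pi/2] *)
  (forall x, annulus m r x ->
     exists lam, eigvals (gSch rho x) lam /\ closure Ga lam /\ f lam = 0) ->
  (* h(g) = c on the boundary of the upper hemisphere *)
  (forall x, equator m x -> hmean rho x = c) ->
  (* e^{2 rho} + |grad rho|^2 is proper on A(r,pi/2] *)
  proper_on (annulus m r) (fun x => expR (2 * rho x) + grad0_sq rho x) ->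
  (* lambda(g) is unbounded on A(r,pi/2] *)
  forall B : R, exists x, annulus m r x /\
    exists lam, eigvals (gSch rho x) lam /\ exists i, B < `|lam 0 i|.
Proof.
move=> m3 r0 rpi c0 _ _ [_ [_ [_ [_ [_ [Gasum _]]]]]] [U [oU [sU [[[dr _] dpr'] _]]]].
move=> Heig Hh Hproper B; apply: contrapT => nB.
have dpr i z (Uz : U z) : differentiable (pd i (rhoc rho)) z := (dpr' i).1 z Uz.
have lamB x lam i : annulus m r x -> eigvals (gSch rho x) lam -> `|lam 0 i| <= B.
  move=> Ax Elam; rewrite leNgt; apply/negP => h; apply: nB.
  by exists x; split=> //; exists lam; split=> //; exists i.
have k0 : 0 < cos r by apply: cos_gt0_pihalf; rewrite rpi andbT; move: r0 rpi; lra.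
have k1 : cos r < 1.
  have p0 : 0 < pi :> R by exact: pi_gt0.
  rewrite -cos0 ltr_cos ?in_itv/= ?lexx ?(ltW p0)//; last first.
    by apply/andP; split; move: r0 rpi p0; lra.
set d2 := (1 - cos r) / (1 + cos r).
have d2_gt0 : 0 < d2 by rewrite divr_gt0 ?subr_gt0// addr_gt0.
have d2_lt1 : d2 < 1 by rewrite ltr_pdivrMr ?addr_gt0//; move: k0; lra.
have Ann y : d2 < sqn y <= 1 -> annulus m r (istereo y) by move=> h; exact/annulus_istereo.
have shellU z : d2 < sqn z <= 1 -> U z.
  by move=> /Ann h; apply: sU; exists (istereo z) => //; exact: istereoK.
have schE i j y : d2 < sqn y <= 1 -> gSch rho (istereo y) i j = sch (theta rho) i j y.
  by move=> /shellU Uy; rewrite (gSch_istereo oU dr dpr m3).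
(* The shell is nonempty and m > 0, so [B] bounds the absolute value of some eigenvalue. *)
have B0 : 0 <= B.
  have [y y1] : exists y : 'rV[R]_m, sqn y = 1.
    by have [e [e1 _]] := exists_unit_orthogonal (0 : 'rV[R]_m) (ltnW m3); exists e.
  have yO : d2 < sqn y <= 1 by rewrite y1 d2_lt1 lexx.
  have [lam [El _]] := Heig _ (Ann _ yO).
  by rewrite (le_trans _ (lamB _ _ (Ordinal (ltnW (ltnW m3))) (Ann _ yO) El)).
have K0 : 0 <= m%:R * B ^+ 2 by rewrite mulr_ge0// sqr_ge0.
apply: (@shell_contradiction R m (theta rho) U d2 (m%:R * B ^+ 2) (ltnW m3)
  (differentiable_theta_on dr) (differentiable_pd_theta_on oU dr dpr)
  (hess_theta_sym oU dr dpr) d2_gt0 d2_lt1 shellU K0).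
- move=> y yO; have [lam [El _]] := Heig _ (Ann _ yO).
  have sym : (gSch rho (istereo y))^T = gSch rho (istereo y).
    apply/matrixP => i j; rewrite mxE !schE// /sch.
    by rewrite (hess_theta_sym oU dr dpr i j (shellU _ yO)) [j == i]eq_sym [pd j (theta rho) y * _]mulrC.
  have := eigvals_frobenius sym El.
  under eq_bigr do under eq_bigr do rewrite schE//.
  move=> ->; rewrite -sum_ord_const ler_sum// => i _.
  rewrite -real_normK ?num_real// lerXn2r ?nnegrE//.
  exact: (lamB _ _ i (Ann _ yO) El).
- move=> y yO; have [lam [El [Gl _]]] := Heig _ (Ann _ yO).
  have := eigvals_trace El; rewrite /mxtrace.
  under eq_bigr do rewrite schE//.
  by move=> ->; exact: (closure_sum_ge0 Gasum).
- move=> y y1.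
  have yO : d2 < sqn y <= 1 by rewrite y1 d2_lt1 lexx.
  have Uy := shellU _ yO.
  have : equator m (istereo y).
    by split; [exact: sphere_istereo|rewrite istereo_max y1 subrr mul0r].
  move=> /Hh; rewrite hmean_istereo => hc.
  have : 0 <= expR (- rhoc rho y) * \sum_(i < m) pd i (rhoc rho) y * y 0 i by rewrite hc.
  rewrite pmulr_rge0 ?expR_gt0// => h.
  (* On |y| = 1 the factor 2 / (1 + |y|^2) is 1, so the correction sums to -|y|^2 = -1. *)
  rewrite (eq_bigr (fun i => pd i (rhoc rho) y * y 0 i - y 0 i ^+ 2)); last first.
    by move=> i _; rewrite pd_theta ?y1; [field|exact: dr].
  by rewrite sumrB -/(sqn y) y1; move: h; lra.
- move=> B'.
  set E := fun x => expR (2 * rho x) + grad0_sq rho x in Hproper.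
  (* On |y| <= 1 one has exp(2 rho) <= exp(2 theta), and |D rho|^2 <= 2 |D theta|^2 + 8 |y|^2. *)
  pose B1 := expR (2 * B') + 2 * B' + 8.
  have EB y : d2 < sqn y <= 1 -> theta rho y <= B' ->
      \sum_(l < m) pd l (theta rho) y ^+ 2 <= B' -> 0 <= E (istereo y) <= B1.
    move=> yO tB NB; have Uy := shellU _ yO.
    rewrite /E grad0_sq_istereo -/(rhoc rho y).
    have [S0 S1] : 0 <= sqn y /\ sqn y <= 1 by split; [exact: sqn_ge0|case/andP: yO].
    have q1 : (1 + sqn y) ^+ 2 / 4 <= 1 by rewrite expr2; nra.
    have q0 : 0 <= (1 + sqn y) ^+ 2 / 4 by rewrite mulr_ge0 ?sqr_ge0.
    have G0 : 0 <= \sum_i pd i (rhoc rho) y ^+ 2.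
      by apply: sumr_ge0 => i _; exact: sqr_ge0.
    have G1 : \sum_i pd i (rhoc rho) y ^+ 2 <= 2 * B' + 8.
      apply: (@le_trans _ _ (\sum_i (2 * pd i (theta rho) y ^+ 2 + 8 * y 0 i ^+ 2))).
        apply: ler_sum => i _; rewrite pd_theta; last exact: dr.
        have v1 : (1 + sqn y)^-1 <= 1 by rewrite invf_le1 ?add1_sqn_gt0// lerDl.
        have v0 : 0 <= (1 + sqn y)^-1 by rewrite invr_ge0 ltW// add1_sqn_gt0.
        move: (pd i _ _) (y 0 i) (_^-1) v0 v1 => a b v v0 v1.
        have : (v * b) ^+ 2 <= b ^+ 2.
          by rewrite exprMn ler_piMl ?sqr_ge0// expr_le1.
        have := sqr_ge0 (a - 4 * (v * b)).
        by rewrite !expr2; lra.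
      by rewrite big_split/= -!mulr_sumr -/(sqn y); move: NB S1; lra.
    have E1 : expR (2 * rhoc rho y) <= expR (2 * B').
      rewrite (@le_trans _ _ (expR (2 * theta rho y)))//; last by rewrite ler_expR ler_pM2l.
      rewrite -expR_rhoc ler_peMr ?expR_ge0// ler_pdivlMr ?exprn_gt0 ?add1_sqn_gt0//.
      by rewrite mul1r expr2; nra.
    have := expR_ge0 (2 * rhoc rho y).
    have : (1 + sqn y) ^+ 2 / 4 * (\sum_i pd i (rhoc rho) y ^+ 2) <= 2 * B' + 8.
      by rewrite (le_trans _ G1)// ler_piMl.
    have := mulr_ge0 q0 G0.
    by rewrite /B1 => h1 h2 h3; apply/andP; split; move: h1 h2 h3 E1; lra.
  pose A := [set x | annulus m r x /\ `[0, B1]%classic (E x)].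
  have cA : compact A by apply: Hproper; exact: segment_compact.
  have [A0|A0] := pselect (A !=set0); last first.
    exists 1 => // y yO tB NB; exfalso; apply: A0; exists (istereo y).
    by split; [exact: Ann|rewrite /= in_itv/= EB].
  (* On the compact preimage the height attains a maximum k < cos r, so its points have |y|^2 >= (1
     - k) / (1 + k) > d2. *)
  have [] := @compact_EVT_max _ R (fun x : 'rV[R]_m.+1 => x 0 ord_max) A A0 cA.
    by apply: continuous_subspaceT => x; exact: coord_continuous.
  move=> x /set_mem[Ax _] xmax.
  have /andP[x0 xr] : 0 <= x 0 ord_max < cos r.
    by apply/annulusP => //; case: Ax.
  set k := x 0 ord_max in x0 xr.
  have kp : 0 < 1 + k by rewrite ltr_wpDr.
  exists ((1 - k) / (1 + k) - d2).
    rewrite subr_gt0 /d2 ltr_pdivlMr// mulrAC ltr_pdivrMr ?addr_gt0//.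
    by move: xr; lra.
  move=> y yO tB NB; rewrite addrCA subrr addr0.
  have : istereo y 0 ord_max <= k.
    by apply: xmax; apply/mem_set; split; [exact: Ann|rewrite /= in_itv/= EB].
  rewrite istereo_max ler_pdivrMr ?add1_sqn_gt0// ler_pdivrMr//.
  by lra.
Qed.
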